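(* Let $Q=[0,1]^3$. For a finite set $Y=\{y_1,\dots,y_n\}\subseteq Q$ define the energy \[E(Y)=\int_Q \operatorname{dist}^2(x,Y)\,dx=\sum_{k=1}^n\int_{V_k}|x-y_k|^2\,dx,\] where $V_k=\{x\in Q: |x-y_k|\le |x-y_i|\ \forall i\neq k\}$ is the Voronoi cell of $y_k$. Let $\omega_3:=4\pi/3$ and define the constants \[\Gamma_1:=\frac{(2/5)^{2/3}}{40},\qquad \Gamma_3:=\omega_3^{-1/5}\Gamma_1^{1/5},\qquad \Gamma_5:=\frac14\Big(\sqrt{1+\tfrac{2^4\cdot 3^3}{5^2\cdot 10^3}}-1\Big)\Gamma_3,\] \[\Gamma_4:=\frac{2\cdot 12^{1/4}\,16^{1/3}}{\pi^{1/4}\omega_3^{1/12}}\Big(\sqrt{1+\tfrac{2^4\cdot 3^3}{5^2\cdot 10^3}}-1\Big)^{-1/2}\Big(\frac{5^2\cdot 10^3}{2^2\cdot 3^3}\Big)^{1/4},\qquad N_\ast:=2(3\Gamma_4/\Gamma_5)^3 .\] (Numerically $\Gamma_1\approx 0.013572$, $\Gamma_3\approx0.317769$, $\Gamma_5\approx 0.000451$, $\Gamma_4\approx 333.18$, $N_\ast\approx 2.94\times 10^{20}$.) (i) Let $n\in\mathbb{N}$ and let $Y_n$ be a minimizer of $E$ among all sets of $n$ points in $Q$. Then for every $y\in Y_n$, with $V$ its Voronoi cell, \[\operatorname{diam}(V)\ge \Gamma_3 n^{-1/3},\qquad |V|\ge \omega_3\Gamma_5^3 n^{-1},\qquad \operatorname{diam}(V)\le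 \Gamma_4 (n-2)^{-1/3},\] and $V$ has at most $N_\ast$ faces. (ii) Let $(Y_n)_n$ be a sequence of minimizers, $Y_n\in\operatorname{argmin}_{\sharp Y=n}E(Y)$, and let $\tau>0$ be the constant such that $n^{2/3}E(Y_n)\to\tau$ for every such sequence of minimizers. Then \[n^{2/3}E(Y_n)\ge \tau\quad\text{for all } n\gg 1,\qquad\text{and}\qquad \tau\ge \frac{2\pi}{5}\,\omega_3^{-5/3}\approx 0.11545 .\]
   Context: Minimizers are taken over all sets $Y\subseteq Q$ with exactly $n$ points ($\sharp Y=n$). Voronoi cells are taken inside $Q$ and are convex polytopes. The existence of the constant $\tau$ in (ii) (the limit $n^{2/3}E(Y_n)\to\tau$ for any sequence of minimizers) is a known result (Zador's formula) taken as given. *)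

(* Defs.v *)
From HB Require Import structures.
From mathcomp Require Import all_boot all_order all_algebra.
From mathcomp Require Import all_classical all_reals all_analysis.
Set Implicit Arguments. Unset Strict Implicit. Unset Printing Implicit Defensive.
Import Order.TTheory GRing.Theory Num.Theory.
Local Open Scope classical_set_scope.
Local Open Scope ring_scope.

Section Defs.
Variable R : realType.

Definition pt := (R * R * R)%type.

Definition c1 (x : pt) : R := x.1.1.
Definition c2 (x : pt) : R := x.1.2.
Definition c3 (x : pt) : R := x.2.

Definition edist (x y : pt) : R :=
  Num.sqrt ((c1 x - c1 y) ^+ 2 + (c2 x - c2 y) ^+ 2 + (c3 x - c3 y) ^+ 2).

Definition leb3 := ((@lebesgue_measure R \x @lebesgue_measure R) \x
                     @lebesgue_measure R)%E.

Definition cubeQ : set pt :=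
  [set x | (0 <= c1 x <= 1) /\ (0 <= c2 x <= 1) /\ (0 <= c3 x <= 1)].

Definition config n (Y : 'I_n -> pt) : Prop :=
  injective Y /\ forall k, cubeQ (Y k).

(* dist^2(x, Y) = inf_k |x - y_k|^2 (+oo for the empty configuration) *)
Definition dist2 n (Y : 'I_n -> pt) (x : pt) : \bar R :=
  ereal_inf [set ((edist x (Y k)) ^+ 2)%:E | k in [set: 'I_n]].

Definition energy n (Y : 'I_n -> pt) : \bar R :=
  (\int[leb3]_(x in cubeQ) dist2 Y x)%E.

Definition minimizer n (Y : 'I_n -> pt) : Prop :=
  config Y /\ forall Y' : 'I_n -> pt, config Y' -> (energy Y <= energy Y')%E.

Definition voronoi n (Y : 'I_n -> pt) (k : 'I_n) : set pt :=
  [set x | cubeQ x /\ forall i, edist x (Y k) <= edist x (Y i)].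

(* diameter of a (bounded, nonempty) set *)
Definition diam (V : set pt) : R :=
  sup [set edist x y | x in V & y in V].

Definition dot (a x : pt) : R := c1 a * c1 x + c2 a * c2 x + c3 a * c3 x.
Definition psub (x y : pt) : pt := ((c1 x - c1 y, c2 x - c2 y), c3 x - c3 y).
Definition cross (u v : pt) : pt :=
  ((c2 u * c3 v - c3 u * c2 v, c3 u * c1 v - c1 u * c3 v),
   c1 u * c2 v - c2 u * c1 v).
Definition pzero : pt := ((0, 0), 0).

(* F is a (2-dimensional) face of the convex polytope V: the intersection of V
   with a supporting plane {a.x = b}, containing 3 affinely independent points *)
Definition is_face (V F : set pt) : Prop :=
  exists (a : pt) (b : R), a <> pzero /\
    (forall x, V x -> dot a x <= b) /\
    F = [set x | V x /\ dot a x = b] /\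
    exists p q r, F p /\ F q /\ F r /\ cross (psub q p) (psub r p) <> pzero.

Definition at_most_faces (V : set pt) (N : R) : Prop :=
  forall (m : nat) (F : nat -> set pt),
    (forall i, (i < m)%N -> is_face V (F i)) ->
    (forall i j, (i < m)%N -> (j < m)%N -> F i = F j -> i = j) ->
    m%:R <= N.

Definition omega3 : R := 4 * pi / 3.
Definition Gamma1 : R := powR (2 / 5) (2 / 3) / 40.
Definition Gamma3 : R := powR omega3 (- (1 / 5)) * powR Gamma1 (1 / 5).
Definition sq_term : R :=
  Num.sqrt (1 + (2 ^+ 4 * 3 ^+ 3) / (5 ^+ 2 * 10 ^+ 3)) - 1.
Definition Gamma5 : R := (1 / 4) * sq_term * Gamma3.
Definition Gamma4 : R :=
  (2 * powR 12 (1 / 4) * powR 16 (1 / 3)) /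
    (powR pi (1 / 4) * powR omega3 (1 / 12)) *
  powR sq_term (- (1 / 2)) *
  powR ((5 ^+ 2 * 10 ^+ 3) / (2 ^+ 2 * 3 ^+ 3)) (1 / 4).
Definition Nstar : R := 2 * (3 * Gamma4 / Gamma5) ^+ 3.

End Defs.

(* Main.v *)
(* For a minimizer, no competitor obtained by moving points can decrease the
   energy. Deleting a point costs at most (2 diam)^2 on its cell, since its
   nearest neighbour is at distance at most 2 diam of every point of the cell.
   Some cell has volume at least 1/n, and splitting its point in two along the
   best coordinate axis gains at least n^(-5/3) / 70. Comparing the two gives the
   lower bounds on diameter and volume. Conversely some cell has volume at most
   1/n, so its point is cheap to delete; moving it to a point at distance r of Y
   gains of order r^5, which bounds the covering radius, hence the diameter, by a
   multiple of n^(-1/3). All cells near a given one being neither long nor small,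
   a packing argument bounds the number of faces.
   For (ii), eight half-size copies of a configuration give E(8n) <= E(n)/4, so
   n^(2/3) E(Y_n) does not increase along n, 8n, 64n, ... and dominates its limit;
   a layer-cake estimate with cubes in place of balls bounds it below. Minimizers
   exist by compactness, so that the hypothesis on tau is not vacuous.
   The factors of slack in the constants are what allows cubes throughout. *)

Require Import Defs.
From HB Require Import structures.
From mathcomp Require Import all_boot all_order all_algebra.
From mathcomp Require Import all_classical all_reals all_analysis.
From mathcomp Require Import measurable_realfun ring lra.
Set Implicit Arguments. Unset Strict Implicit. Unset Printing Implicit Defensive.
Import Order.TTheory GRing.Theory Num.Theory.
Import numFieldNormedType.Exports.
Local Open Scope classical_set_scope.
Local Open Scope ring_scope.

Local Notation edist := Defs.edist.

(** * Integrals of weighted indicators, and boxes *)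

(** No integral over a Voronoi cell is ever evaluated. Each variation is reduced to one pointwise
    inequality between [d2] of the competitors and [d2 Y], up to constants times indicators, and
    only then integrated; what remains are volumes. Level sets are taken for the sup-norm [linf],
    whose balls are boxes. The power n^(-1/3) enters as a real [s] with [s ^+ 3 = n%:R^-1], so that
    the estimates become polynomial inequalities with rational coefficients. The order of the bounds
    matters: the cost of a deletion is controlled by the diameter, so the lower bound on volumes
    needs the upper bound on diameters, which in turn comes from the covering radius. The constants
    reached there, 48 for the diameter and 15 / 10^7 for the volume, are far better than [Gamma4]
    (about 333) and [omega3 * Gamma5 ^+ 3] (about 4e-10). Little room is left only for [Gamma3] and
    for the bound on tau, and these two dictate the step sizes of the layer cakes. *)

Section WeightedIndicators.
Context d (T : measurableType d) (R : realType) (mu : {measure set T -> \bar R}).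
Variables (Q : set T) (mQ : measurable Q) (finQ : (mu Q < +oo)%E).

Lemma sub_fin_measure (A : set T) : measurable A -> A `<=` Q ->
  mu A = (fine (mu A))%:E.
Proof.
move=> mA AQ; rewrite fineK// ge0_fin_numE//.
by apply: le_lt_trans finQ; apply: le_measure => //; rewrite inE.
Qed.

Lemma integral_add_indic (I : finType) (F : T -> R) (g : I -> R) (B : I -> set T) :
  measurable_fun Q F -> (forall x, Q x -> 0 <= F x) ->
  (forall i, 0 <= g i) -> (forall i, measurable (B i)) -> (forall i, B i `<=` Q) ->
  (\int[mu]_(x in Q) (F x + \sum_i g i * \1_(B i) x)%:E =
   \int[mu]_(x in Q) (F x)%:E + (\sum_i g i * fine (mu (B i)))%:E)%E.
Proof.
move=> mF F0 g0 mB BQ.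
have mI i : measurable_fun Q (fun x => g i * \1_(B i) x).
  by apply: measurable_funM => //.
have mF' : measurable_fun Q (fun x => (F x)%:E) by exact/measurable_EFinP.
have mS : measurable_fun Q (fun x => (\sum_i g i * \1_(B i) x)%:E).
  by apply/measurable_EFinP; apply: measurable_sum => i.
have S0 x : Q x -> (0 <= (\sum_i g i * \1_(B i) x)%:E)%E.
  by move=> _; rewrite lee_fin sumr_ge0// => i _; rewrite mulr_ge0.
under eq_integral do rewrite EFinD.
rewrite ge0_integralD//=.
congr (_ + _)%E.
under eq_integral do rewrite -sumEFin.
rewrite ge0_integral_sum//=; first last.
- by move=> i x _; rewrite lee_fin mulr_ge0.
- by move=> i; apply/measurable_EFinP; exact: mI.
rewrite -sumEFin; apply: eq_bigr => i _.
under eq_integral do rewrite EFinM.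
rewrite ge0_integralZl_EFin//=; last first.
  by apply/measurable_EFinP.
rewrite integral_indic// EFinM -sub_fin_measure//.
by rewrite setIidl.
Qed.

(** Gains stand on the left and losses on the right, so that no subtraction of extended reals
    occurs. *)
Lemma le_integral_add_indic (I J : finType) (F G : T -> R)
    (g : I -> R) (B : I -> set T) (l : J -> R) (W : J -> set T) :
  measurable_fun Q F -> (forall x, Q x -> 0 <= F x) ->
  measurable_fun Q G -> (forall x, Q x -> 0 <= G x) ->
  (forall i, 0 <= g i) -> (forall i, measurable (B i)) -> (forall i, B i `<=` Q) ->
  (forall i, 0 <= l i) -> (forall i, measurable (W i)) -> (forall i, W i `<=` Q) ->
  (forall x, Q x -> F x + \sum_i g i * \1_(B i) x <=
                    G x + \sum_i l i * \1_(W i) x) ->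
  (\int[mu]_(x in Q) (F x)%:E + (\sum_i g i * fine (mu (B i)))%:E <=
   \int[mu]_(x in Q) (G x)%:E + (\sum_i l i * fine (mu (W i)))%:E)%E.
Proof.
move=> mF F0 mG G0 g0 mB BQ l0 mW WQ FG.
rewrite -!integral_add_indic//; apply: ge0_le_integral => //.
- move=> x Qx; rewrite lee_fin addr_ge0 ?F0// sumr_ge0// => i _.
  by rewrite mulr_ge0.
- apply/measurable_EFinP; apply: measurable_funD; first by [].
  by apply: measurable_sum => i; exact: measurable_funM.
- apply/measurable_EFinP; apply: measurable_funD; first by [].
  by apply: measurable_sum => i; exact: measurable_funM.
Qed.

End WeightedIndicators.

(** A discrete layer cake: [P k] tests whether level [g k] is reached, and each increment is counted
    only if its upper end is. The induction also carries the bound by [g N]: when the last level is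
    reached, the sum is at most [g N.+1 <= X]. *)
Lemma layer_cake_sum (R : realType) (N : nat) (g : nat -> R) (P : nat -> bool) (X : R) :
  {homo g : i j / (i <= j)%N >-> i <= j} -> g 0%N = 0 -> 0 <= X ->
  (forall k, P k -> g k <= X) ->
  \sum_(k < N) (g k.+1 - g k) * (P k.+1)%:R <= X.
Proof.
move=> g_nd g0 X0 PX.
suff [//] : \sum_(k < N) (g k.+1 - g k) * (P k.+1)%:R <= X /\
            \sum_(k < N) (g k.+1 - g k) * (P k.+1)%:R <= g N.
elim: N => [|N [IH1 IH2]]; first by rewrite big_ord0 g0.
have gN : g N <= g N.+1 by exact: g_nd.
rewrite big_ord_recr /=; case: (boolP (P N.+1)) => [PN|_]; last first.
  by rewrite mulr0 addr0; split=> //; exact: le_trans gN.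
by have := PX _ PN; rewrite mulr1; split; lra.
Qed.

Section Boxes.
Variable R : realType.
Local Notation mR := (measurableTypeR R).
Local Notation mR3 := ((mR * mR * mR)%type).
Local Notation mu := (@leb3 R).

Definition box (a b : pt R) : set mR3 :=
  (`[c1 a, c1 b] `*` `[c2 a, c2 b]) `*` `[c3 a, c3 b].

Lemma boxP (a b x : pt R) : box a b x <->
  [/\ c1 a <= c1 x <= c1 b, c2 a <= c2 x <= c2 b & c3 a <= c3 x <= c3 b].
Proof.
split; last by move=> [h1 h2 h3]; split; [split|]; rewrite /= in_itv.
by move=> [[/=]]; rewrite !in_itv/= => h1 h2 h3; split.
Qed.

Lemma measurable_box (a b : pt R) : measurable (box a b).
Proof. by apply: measurableX => //; apply: measurableX. Qed.

Lemma leb3_box (a b : pt R) : c1 a <= c1 b -> c2 a <= c2 b -> c3 a <= c3 b ->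
  mu (box a b) = ((c1 b - c1 a) * (c2 b - c2 a) * (c3 b - c3 a))%:E.
Proof.
move=> h1 h2 h3.
have E (x y : R) : x <= y -> @lebesgue_measure R `[x, y] = (y - x)%:E.
  rewrite lebesgue_measure_itv/= lte_fin le_eqVlt => /predU1P[->|->//].
  by rewrite ltxx subrr.
rewrite /leb3 /box product_measure1E//; last exact: measurableX.
have E12 := product_measure1E (@lebesgue_measure R) (@lebesgue_measure R)
  (measurable_itv `[c1 a, c1 b]) (measurable_itv `[c2 a, c2 b]).
rewrite [X in (X * _)%E]E12 !EFinM.
by congr (_ * _ * _)%E; exact: E.
Qed.

Lemma cubeQE : @cubeQ R = box ((0, 0), 0) ((1, 1), 1).
Proof.
apply/seteqP; split=> x.
  by move=> [h1 [h2 h3]]; apply/boxP.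
by move=> /boxP[h1 h2 h3]; split.
Qed.

Lemma measurable_cubeQ : @measurable _ mR3 (@cubeQ R).
Proof. by rewrite cubeQE; exact: measurable_box. Qed.

Lemma leb3_cubeQ : mu (@cubeQ R) = 1%E.
Proof. by rewrite cubeQE leb3_box /c1 /c2 /c3/= ?ler01// !subr0 !mulr1. Qed.

Lemma leb3_cubeQ_fin : (mu (@cubeQ R) < +oo)%E.
Proof. by rewrite leb3_cubeQ ltry. Qed.

Lemma measurable_c1 : measurable_fun [set: mR3] (@c1 R : mR3 -> mR).
Proof. exact: (measurableT_comp measurable_fst measurable_fst). Qed.

Lemma measurable_c2 : measurable_fun [set: mR3] (@c2 R : mR3 -> mR).
Proof. exact: (measurableT_comp measurable_snd measurable_fst). Qed.

Lemma measurable_c3 : measurable_fun [set: mR3] (@c3 R : mR3 -> mR).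
Proof. exact: measurable_snd. Qed.

End Boxes.

(** * Distances, configurations and energy *)

Section SquaredDistance.
Variable R : realType.
Local Notation mR := (measurableTypeR R).
Local Notation mR3 := ((mR * mR * mR)%type).
Local Notation mu := (@leb3 R).

Definition sq (x y : pt R) : R :=
  (c1 x - c1 y) ^+ 2 + (c2 x - c2 y) ^+ 2 + (c3 x - c3 y) ^+ 2.

Lemma sq_ge0 (x y : pt R) : 0 <= sq x y.
Proof. by rewrite !addr_ge0// sqr_ge0. Qed.

Lemma sqxx (x : pt R) : sq x x = 0.
Proof. by rewrite /sq !subrr expr0n/= !addr0. Qed.

Lemma sqC (x y : pt R) : sq x y = sq y x.
Proof. by rewrite /sq; ring. Qed.

Lemma sq_eq0 (x y : pt R) : sq x y = 0 -> x = y.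
Proof.
move=> /eqP; rewrite /sq !paddr_eq0 ?addr_ge0 ?sqr_ge0// !sqrf_eq0 !subr_eq0.
move: x y => [[x1 x2] x3] [[y1 y2] y3]; rewrite /c1 /c2 /c3/=.
by move=> /andP[/andP[/eqP-> /eqP->] /eqP->].
Qed.

Lemma edist_sqr (x y : pt R) : edist x y ^+ 2 = sq x y.
Proof. by rewrite /edist sqr_sqrtr// sq_ge0. Qed.

Lemma edist_ge0 (x y : pt R) : 0 <= edist x y.
Proof. exact: sqrtr_ge0. Qed.

Lemma edist_leE (x y z w : pt R) : (edist x y <= edist z w) = (sq x y <= sq z w).
Proof. by rewrite /edist ler_sqrt// sq_ge0. Qed.

Lemma edistC (x y : pt R) : edist x y = edist y x.
Proof. by rewrite /edist -/(sq x y) -/(sq y x) sqC. Qed.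

Lemma cauchy_schwarz3 (a b c a' b' c' : R) :
  (a * a' + b * b' + c * c') ^+ 2 <=
  (a ^+ 2 + b ^+ 2 + c ^+ 2) * (a' ^+ 2 + b' ^+ 2 + c' ^+ 2).
Proof.
rewrite -subr_ge0.
have -> : (a ^+ 2 + b ^+ 2 + c ^+ 2) * (a' ^+ 2 + b' ^+ 2 + c' ^+ 2) -
    (a * a' + b * b' + c * c') ^+ 2 =
  (a * b' - b * a') ^+ 2 + (a * c' - c * a') ^+ 2 + (b * c' - c * b') ^+ 2.
  by ring.
by rewrite !addr_ge0// sqr_ge0.
Qed.

Lemma edist_triangle (x y z : pt R) : edist x z <= edist x y + edist y z.
Proof.
have h0 := edist_ge0 x y; have h1 := edist_ge0 y z.
rewrite -(@ler_pXn2r _ 2)// ?nnegrE ?edist_ge0 ?addr_ge0//.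
rewrite sqrrD !edist_sqr.
set u := edist x y * edist y z.
have u0 : 0 <= u by rewrite mulr_ge0.
have u2 : u ^+ 2 = sq x y * sq y z by rewrite exprMn !edist_sqr.
suff h : (c1 x - c1 y) * (c1 y - c1 z) + (c2 x - c2 y) * (c2 y - c2 z) +
         (c3 x - c3 y) * (c3 y - c3 z) <= u.
  by rewrite /sq in u2 *; lra.
have := cauchy_schwarz3 (c1 x - c1 y) (c2 x - c2 y) (c3 x - c3 y)
   (c1 y - c1 z) (c2 y - c2 z) (c3 y - c3 z).
rewrite -/(sq x y) -/(sq y z) -u2 => h.
apply: le_trans (ler_norm _) _.
by rewrite -(@ler_pXn2r _ 2)// ?nnegrE// real_normK// num_real.
Qed.

Lemma sq_cubeQ_le3 (x y : pt R) : cubeQ x -> cubeQ y -> sq x y <= 3.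
Proof.
move=> [/andP[? ?] [/andP[? ?] /andP[? ?]]] [/andP[? ?] [/andP[? ?] /andP[? ?]]].
rewrite /sq; nra.
Qed.

Lemma measurable_sq (y : pt R) : measurable_fun [set: mR3] (fun x : mR3 => sq x y).
Proof.
apply: measurable_funD; first apply: measurable_funD.
- apply: measurable_funX; apply: measurable_funB; last exact: measurable_cst.
  exact: measurable_c1.
- apply: measurable_funX; apply: measurable_funB; last exact: measurable_cst.
  exact: measurable_c2.
- apply: measurable_funX; apply: measurable_funB; last exact: measurable_cst.
  exact: measurable_c3.
Qed.

Definition clamp01 (a : R) : R := Num.max 0 (Num.min a 1).

Lemma clamp01_bounds (a : R) : 0 <= clamp01 a <= 1.
Proof. by rewrite /clamp01 le_max lexx ge_max ler01 ge_min lexx orbT. Qed.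

Lemma clamp01_sqr (a x : R) : 0 <= x <= 1 -> (x - clamp01 a) ^+ 2 <= (x - a) ^+ 2.
Proof.
move=> /andP[x0 x1]; rewrite /clamp01; case: (leP a 1) => a1; last first.
  rewrite (max_r ler01) -subr_ge0.
  have -> : (x - a) ^+ 2 - (x - 1) ^+ 2 = (a - 1) * ((a - 1) + 2 * (1 - x)) by ring.
  by apply: mulr_ge0; lra.
case: (leP 0 a) => // a0; rewrite -subr_ge0.
have -> : (x - a) ^+ 2 - (x - 0) ^+ 2 = - a * (- a + 2 * x) by ring.
by apply: mulr_ge0; lra.
Qed.

Definition clampQ (z : pt R) : pt R := ((clamp01 (c1 z), clamp01 (c2 z)), clamp01 (c3 z)).

Lemma clampQ_in (z : pt R) : cubeQ (clampQ z).
Proof. by split; [|split]; exact: clamp01_bounds. Qed.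

Lemma clampQ_sq (x z : pt R) : cubeQ x -> sq x (clampQ z) <= sq x z.
Proof.
by move=> [? [? ?]]; rewrite /sq; apply: lerD; [apply: lerD|]; exact: clamp01_sqr.
Qed.

End SquaredDistance.

Section Configurations.
Variable R : realType.
Local Notation mR := (measurableTypeR R).
Local Notation mR3 := ((mR * mR * mR)%type).
Local Notation mu := (@leb3 R).

Lemma fresh_point (s : seq (pt R)) : exists p : pt R, cubeQ p /\ p \notin s.
Proof.
pose g (i : nat) : pt R := ((i.+1%:R^-1, 0), 0).
have gQ i : cubeQ (g i).
  split; [|split]; rewrite /c1 /c2 /c3/= ?lexx ?ler01//.
  by rewrite invr_ge0 ler0n/= invf_le1// ler1n.
have g_inj : injective g.
  by move=> i j [] /invr_inj/eqP; rewrite eqr_nat => /eqP[].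
apply: contrapT => h.
have sub : {subset [seq g i | i <- iota 0 (size s).+1] <= s}.
  move=> _ /mapP[i _ ->]; apply: contrapT => /negP gi.
  by apply: h; exists (g i); split=> //; exact: gQ.
have := uniq_leq_size _ sub; rewrite map_inj_uniq// iota_uniq => /(_ isT).
by rewrite size_map size_iota ltnn.
Qed.

Lemma extend_uniq (j : nat) (s : seq (pt R)) : uniq s -> (forall x, x \in s -> cubeQ x) ->
  exists s', [/\ uniq s', size s' = (size s + j)%N, {subset s <= s'} &
                 forall x, x \in s' -> cubeQ x].
Proof.
move=> us sQ; elim: j => [|j [s' [us' ss' sub s'Q]]].
  by exists s; split; rewrite ?addn0.
have [p [pQ ps']] := fresh_point s'.
exists (p :: s'); split => /=.
- by rewrite ps'.
- by rewrite ss' addnS.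
- by move=> x /sub xs'; rewrite inE xs' orbT.
- by move=> x; rewrite inE => /predU1P[->|/s'Q].
Qed.

(** Slots freed by repeated values are refilled with fresh points; all values of [Z] survive, so
    [d2] can only decrease. *)
Lemma inject_config n (Z : 'I_n -> pt R) : (forall k, cubeQ (Z k)) ->
  exists Z' : 'I_n -> pt R, config Z' /\ forall k, exists k', Z' k' = Z k.
Proof.
move=> ZQ; pose s := undup (codom Z).
have ss : (size s <= n)%N.
  by rewrite (leq_trans (size_undup _))// size_codom card_ord.
have sQ x : x \in s -> cubeQ x by rewrite mem_undup => /codomP[k ->].
have [s' [us' ss' sub s'Q]] := extend_uniq (n - size s) (undup_uniq _) sQ.
rewrite subnKC// in ss'.
exists (fun k : 'I_n => nth (pzero R) s' k); split; first split.
- move=> i j /eqP; rewrite nth_uniq ?ss'// => /eqP; exact: val_inj.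
- by move=> k; apply: s'Q; rewrite mem_nth// ss'.
- move=> k; have Zk : Z k \in s' by apply: sub; rewrite mem_undup codom_f.
  have lt : (index (Z k) s' < n)%N by move: Zk; rewrite -index_mem ss'.
  by exists (Ordinal lt); rewrite /= nth_index.
Qed.

Lemma nearest_index n (Y : 'I_n -> pt R) (x : pt R) : (0 < n)%N ->
  exists k, forall i, sq x (Y k) <= sq x (Y i).
Proof.
case: n Y => // n Y _.
by case: (arg_minP (fun k => sq x (Y k)) (isT : xpredT (@ord0 n))) => k _ h; exists k => i; exact: h.
Qed.

Lemma dist2_nearest n (Y : 'I_n -> pt R) (x : pt R) k :
  (forall i, sq x (Y k) <= sq x (Y i)) -> dist2 Y x = (sq x (Y k))%:E.
Proof.
move=> h; apply/eqP; rewrite eq_le; apply/andP; split.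
  by apply: ereal_inf_lbound; exists k => //; rewrite edist_sqr.
by apply: le_ereal_inf_tmp => _ [i _ <-]; rewrite edist_sqr lee_fin.
Qed.

Definition d2 n (Y : 'I_n -> pt R) (x : pt R) : R := fine (dist2 Y x).

Lemma dist2E n (Y : 'I_n -> pt R) (x : pt R) : (0 < n)%N -> dist2 Y x = (d2 Y x)%:E.
Proof.
by move=> n0; rewrite /d2; have [k /dist2_nearest ->] := nearest_index Y x n0.
Qed.

Lemma d2_nearest n (Y : 'I_n -> pt R) (x : pt R) k :
  (forall i, sq x (Y k) <= sq x (Y i)) -> d2 Y x = sq x (Y k).
Proof. by rewrite /d2 => /dist2_nearest ->. Qed.

Lemma d2_le n (Y : 'I_n -> pt R) (x : pt R) i : d2 Y x <= sq x (Y i).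
Proof.
have [|k h] := nearest_index Y x; first by case: n {Y} i => // -[].
by rewrite (d2_nearest h).
Qed.

Lemma d2_ge0 n (Y : 'I_n -> pt R) (x : pt R) : 0 <= d2 Y x.
Proof.
case: n Y => [|n] Y.
  (* Without points the infimum is +oo, and [fine] sends it to 0. *)
  rewrite /d2 /dist2 (_ : [set _ | _ in _] = set0) ?ereal_inf0//.
  by apply/seteqP; split=> // ? [[]].
by have [//|k h] := nearest_index Y x; rewrite (d2_nearest h) sq_ge0.
Qed.

Lemma d2_attained n (Y : 'I_n -> pt R) (x : pt R) : (0 < n)%N ->
  exists k, d2 Y x = sq x (Y k).
Proof. by move=> n0; have [k /d2_nearest] := nearest_index Y x n0; exists k. Qed.

Lemma le_d2 n (Y : 'I_n -> pt R) (x : pt R) (a : R) : (0 < n)%N ->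
  (forall i, a <= sq x (Y i)) -> a <= d2 Y x.
Proof. by move=> n0 h; have [k ->] := d2_attained Y x n0. Qed.

Lemma measurable_d2 n (Y : 'I_n -> pt R) : (0 < n)%N ->
  measurable_fun [set: mR3] (d2 Y : mR3 -> R).
Proof.
case: n Y => // n Y _.
have -> : (d2 Y : mR3 -> R) =
    fun x : mR3 => \big[Num.min/sq x (Y ord0)]_(k <- enum 'I_n.+1) sq x (Y k).
  apply/funext => x; apply/eqP; rewrite eq_le; apply/andP; split.
    elim: (enum 'I_n.+1) => [|i s IH]; first by rewrite big_nil d2_le.
    by rewrite big_cons le_min d2_le.
  have [//|k ->] := d2_attained Y x.
  have: k \in enum 'I_n.+1 by rewrite mem_enum.
  elim: (enum 'I_n.+1) => // i s IH; rewrite inE big_cons ge_min => /predU1P[->|/IH->].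
    by rewrite lexx.
  by rewrite orbT.
elim: (enum 'I_n.+1) => [|i s IH].
  under eq_fun do rewrite big_nil; exact: measurable_sq.
under eq_fun do rewrite big_cons.
by apply: measurable_minr => //; exact: measurable_sq.
Qed.

Lemma energyE n (Y : 'I_n -> pt R) : (0 < n)%N ->
  energy Y = (\int[mu]_(x in (@cubeQ R : set mR3)) (d2 Y x)%:E)%E.
Proof. by move=> n0; apply: eq_integral => x _; rewrite dist2E. Qed.

Lemma energy_ge0 n (Y : 'I_n -> pt R) : (0 < n)%N -> (0 <= energy Y)%E.
Proof.
by move=> n0; rewrite energyE//; apply: integral_ge0 => x _; rewrite lee_fin d2_ge0.
Qed.

Lemma measurable_d2Q n (Y : 'I_n -> pt R) : (0 < n)%N ->
  measurable_fun (@cubeQ R : set mR3) (d2 Y : mR3 -> R).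
Proof. by move=> n0; apply: measurable_funTS; exact: measurable_d2. Qed.

Lemma energy_le n m (Y : 'I_n -> pt R) (Z : 'I_m -> pt R) : (0 < n)%N -> (0 < m)%N ->
  (forall x, cubeQ x -> d2 Y x <= d2 Z x) -> (energy Y <= energy Z)%E.
Proof.
move=> n0 m0 h; rewrite !energyE//; apply: ge0_le_integral.
- exact: measurable_cubeQ.
- by move=> x _; rewrite lee_fin d2_ge0.
- by apply/measurable_EFinP; exact: measurable_d2Q.
- by apply/measurable_EFinP; exact: measurable_d2Q.
- by move=> x Qx; rewrite lee_fin h.
Qed.

(* Configurations with repeated points, or points outside the cube, are not
   competitors by definition; they are nevertheless never better. *)
Lemma better_config n (Z : 'I_n -> pt R) : (0 < n)%N ->
  exists Z' : 'I_n -> pt R, config Z' /\ (energy Z' <= energy Z)%E.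
Proof.
move=> n0; have [Z' [cZ' sub]] := inject_config (fun k => clampQ_in (Z k)).
exists Z'; split=> //; apply: energy_le => // x Qx.
apply: le_d2 => // i; have [k' e] := sub i.
by rewrite (le_trans (d2_le Z' x k'))// e clampQ_sq.
Qed.

Lemma minimizer_le n (Y Z : 'I_n -> pt R) : (0 < n)%N -> minimizer Y ->
  (energy Y <= energy Z)%E.
Proof.
move=> n0 [_ minY]; have [Z' [cZ' le]] := better_config Z n0.
exact: le_trans (minY _ cZ') le.
Qed.

Lemma d2_le3 n (Y : 'I_n -> pt R) x : (forall k, cubeQ (Y k)) -> cubeQ x -> (0 < n)%N ->
  d2 Y x <= 3.
Proof. by move=> YQ Qx n0; have [k ->] := d2_attained Y x n0; exact: sq_cubeQ_le3. Qed.

Lemma energy_fin n (Y : 'I_n -> pt R) : (0 < n)%N -> (forall k, cubeQ (Y k)) ->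
  energy Y \is a fin_num.
Proof.
move=> n0 YQ; rewrite ge0_fin_numE ?energy_ge0//.
apply: (@le_lt_trans _ _ (\int[mu]_(x in (@cubeQ R : set mR3)) (cst (3%:E)) x)%E).
  rewrite energyE//; apply: ge0_le_integral => //.
  - exact: measurable_cubeQ.
  - by move=> x _; rewrite lee_fin d2_ge0.
  - by apply/measurable_EFinP; exact: measurable_d2Q.
  - by move=> x Qx; rewrite lee_fin d2_le3.
by rewrite integral_cst; [rewrite [X in (_ * X)%E]leb3_cubeQ mule1 ltry|exact: measurable_cubeQ].
Qed.

End Configurations.

(** * Volumes, competitors and cells *)

Section Volume.
Variable R : realType.
Local Notation mR := (measurableTypeR R).
Local Notation mR3 := ((mR * mR * mR)%type).
Local Notation mu := (@leb3 R).
Local Notation Q := (@cubeQ R : set mR3).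

Definition vol (A : set mR3) : R := fine (mu A).

Lemma vol_ge0 (A : set mR3) : 0 <= vol A.
Proof. exact/fine_ge0/measure_ge0. Qed.

Lemma leb3_vol (A : set mR3) : measurable A -> A `<=` Q -> mu A = (vol A)%:E.
Proof.
move=> mA AQ.
exact: (sub_fin_measure (@measurable_cubeQ R) (leb3_cubeQ_fin R) mA AQ).
Qed.

Lemma vol_cubeQ : vol Q = 1.
Proof. by rewrite /vol leb3_cubeQ. Qed.

(** Covering and packing are both counting statements: at each point, compare how many sets of
    either family contain it. *)
Lemma vol_sum_le (I J : finType) (B : I -> set mR3) (W : J -> set mR3) :
  (forall i, measurable (B i)) -> (forall i, B i `<=` Q) ->
  (forall i, measurable (W i)) -> (forall i, W i `<=` Q) ->
  (forall x, Q x -> \sum_i \1_(B i) x <= \sum_j \1_(W j) x :> R) ->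
  \sum_i vol (B i) <= \sum_j vol (W j).
Proof.
move=> mB BQ mW WQ h.
have := @le_integral_add_indic _ _ _ mu Q (@measurable_cubeQ R) (leb3_cubeQ_fin R)
  I J (cst 0) (cst 0) (cst 1) B (cst 1) W.
move=> /(_ (measurable_cst _) (fun _ _ => lexx _) (measurable_cst _) (fun _ _ => lexx _)
  (fun _ => ler01) mB BQ (fun _ => ler01) mW WQ) H.
under eq_bigr do rewrite -[vol _]mul1r.
under [leRHS]eq_bigr do rewrite -[vol _]mul1r.
have {H} := H _; rewrite integral0 !add0e lee_fin; apply=> x Qx.
rewrite !add0r; have := h _ Qx.
by under eq_bigr do rewrite -[\1_ _ _]mul1r;
   under [leRHS]eq_bigr do rewrite -[\1_ _ _]mul1r.
Qed.

Lemma vol_cover (I : finType) (A : set mR3) (B : I -> set mR3) :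
  measurable A -> A `<=` Q -> (forall i, measurable (B i)) -> (forall i, B i `<=` Q) ->
  (forall x, A x -> exists i, B i x) -> vol A <= \sum_i vol (B i).
Proof.
move=> mA AQ mB BQ h.
have := @vol_sum_le 'I_1 I (fun=> A) B; rewrite big_ord1; apply=> // x Qx.
rewrite big_ord1 indicE; case: (boolP (x \in A)) => [|_]; last by rewrite sumr_ge0.
rewrite inE => /h[i Bi]; rewrite (bigD1 i)//= indicE mem_set// lerDl.
by rewrite sumr_ge0.
Qed.

Lemma vol_packing (I : finType) (A : set mR3) (B : I -> set mR3) :
  measurable A -> A `<=` Q -> (forall i, measurable (B i)) -> (forall i, B i `<=` A) ->
  (forall x i j, B i x -> B j x -> i = j) -> \sum_i vol (B i) <= vol A.
Proof.
move=> mA AQ mB BA h.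
have := @vol_sum_le I 'I_1 B (fun=> A); rewrite big_ord1; apply=> //.
  by move=> i x /BA/AQ.
move=> x Qx; rewrite big_ord1.
have [[i Bi]|none] := pselect (exists i, B i x).
  rewrite (bigD1 i)//= big1 => [|j /eqP ji].
    by rewrite !indicE !mem_set ?addr0//; exact: BA Bi.
  by rewrite indicE memNset// => /(h _ _ _ Bi)/esym.
rewrite big1 ?indicE// => j _; rewrite indicE memNset// => Bj.
by apply: none; exists j.
Qed.

Lemma vol_le (A B : set mR3) : measurable A -> measurable B -> B `<=` Q ->
  A `<=` B -> vol A <= vol B.
Proof.
move=> mA mB BQ AB.
have := @vol_cover 'I_1 A (fun=> B); rewrite big_ord1; apply=> //.
  by move=> x /AB/BQ.
by move=> x /AB; exists ord0.
Qed.

Lemma vol_le_box (A : set mR3) (a b : pt R) : measurable A ->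
  A `<=` box a b -> c1 a <= c1 b -> c2 a <= c2 b -> c3 a <= c3 b ->
  vol A <= (c1 b - c1 a) * (c2 b - c2 a) * (c3 b - c3 a).
Proof.
move=> mA AB h1 h2 h3; have mB := @measurable_box R a b.
have le : (mu A <= ((c1 b - c1 a) * (c2 b - c2 a) * (c3 b - c3 a))%:E)%E.
  by rewrite -leb3_box//; apply: le_measure => //; rewrite inE.
rewrite -lee_fin /vol fineK// ge0_fin_numE//.
exact: le_lt_trans le (ltry _).
Qed.

Lemma vol_le_centered_box (A : set mR3) (p : pt R) (r : R) : measurable A -> 0 <= r ->
  (forall x, A x -> [/\ `|c1 x - c1 p| <= r, `|c2 x - c2 p| <= r & `|c3 x - c3 p| <= r]) ->
  vol A <= 8 * r ^+ 3.
Proof.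
move=> mA r0 h.
pose a : pt R := ((c1 p - r, c2 p - r), c3 p - r).
pose b : pt R := ((c1 p + r, c2 p + r), c3 p + r).
have -> : 8 * r ^+ 3 = (c1 b - c1 a) * (c2 b - c2 a) * (c3 b - c3 a).
  by rewrite /a /b /c1 /c2 /c3/=; ring.
apply: vol_le_box => //; [|rewrite /a /b /c1 /c2 /c3/=; lra..].
move=> x /h[]; rewrite !ler_distl => ? ? ?; apply/boxP.
by rewrite /a /b /c1 /c2 /c3/=.
Qed.

Lemma box_le_vol (A : set mR3) (a b : pt R) : measurable A -> A `<=` Q ->
  box a b `<=` A -> c1 a <= c1 b -> c2 a <= c2 b -> c3 a <= c3 b ->
  (c1 b - c1 a) * (c2 b - c2 a) * (c3 b - c3 a) <= vol A.
Proof.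
move=> mA AQ BA h1 h2 h3; rewrite -[leLHS]/(fine _%:E) -leb3_box//.
by apply: vol_le => //; exact: measurable_box.
Qed.

(** A cube of side 2s about [p] may leave the unit cube, but for s <= 1/2 one of its octants stays
    inside, hence s^3 and not 8 s^3. In the proof [low] picks the inward side for each
    coordinate. *)
Lemma corner_box_le_vol (A : set mR3) (p : pt R) (s : R) : measurable A -> A `<=` Q ->
  cubeQ p -> 0 <= s -> s <= 1 / 2 ->
  (forall x : mR3, Q x -> [/\ `|c1 x - c1 p| <= s, `|c2 x - c2 p| <= s & `|c3 x - c3 p| <= s] -> A x) ->
  s ^+ 3 <= vol A.
Proof.
move=> mA AQ [/andP[? ?] [/andP[? ?] /andP[? ?]]] s0 s1 h.
pose low (t : R) : R := if t <= 1 / 2 then t else t - s.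
pose a : pt R := ((low (c1 p), low (c2 p)), low (c3 p)).
pose b : pt R := ((low (c1 p) + s, low (c2 p) + s), low (c3 p) + s).
have -> : s ^+ 3 = (c1 b - c1 a) * (c2 b - c2 a) * (c3 b - c3 a).
  by rewrite /a /b /c1 /c2 /c3/=; ring.
have lowP (t y : R) : 0 <= t -> t <= 1 -> low t <= y <= low t + s ->
    0 <= y <= 1 /\ `|y - t| <= s.
  rewrite ler_distl /low => ? ?; case: (leP t (1/2)) => ? /andP[? ?].
    by split; apply/andP; split; lra.
  by split; apply/andP; split; lra.
apply: box_le_vol => //; [|rewrite /a /b /c1 /c2 /c3/=; lra..].
move=> x /boxP[] /lowP[]// q1 d1 /lowP[]// q2 d2' /lowP[]// q3 d3.
by apply: h.
Qed.

End Volume.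

(** * Comparing a minimizer with a family of competitors *)

Section Exchange.
Variable R : realType.
Local Notation mR := (measurableTypeR R).
Local Notation mR3 := ((mR * mR * mR)%type).
Local Notation mu := (@leb3 R).
Local Notation Q := (@cubeQ R : set mR3).

(** The energies of the competitors sum to at least [#|K|] times the energy of [Y], which is finite
    and cancels. A family is used because splitting a point is estimated on average over the three
    axes. The [Z e] may repeat points or leave the cube, by [minimizer_le]. *)
Lemma minimizer_exchange n (Y : 'I_n -> pt R) (K I J : finType) (Z : K -> 'I_n -> pt R)
    (g : I -> R) (B : I -> set mR3) (l : J -> R) (W : J -> set mR3) :
  (0 < n)%N -> minimizer Y ->
  (forall i, 0 <= g i) -> (forall i, measurable (B i)) -> (forall i, B i `<=` Q) ->
  (forall i, 0 <= l i) -> (forall i, measurable (W i)) -> (forall i, W i `<=` Q) ->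
  (forall x, Q x -> \sum_e d2 (Z e) x + \sum_i g i * \1_(B i) x <=
                    #|K|%:R * d2 Y x + \sum_j l j * \1_(W j) x) ->
  \sum_i g i * vol (B i) <= \sum_j l j * vol (W j).
Proof.
move=> n0 minY g0 mB BQ l0 mW WQ h.
have mQ := @measurable_cubeQ R.
have mS : measurable_fun Q (fun x => \sum_e d2 (Z e) x).
  by apply: measurable_sum => e; exact: measurable_d2Q.
have mG : measurable_fun Q (fun x => #|K|%:R * d2 Y x).
  by apply: measurable_funM => //; exact: measurable_d2Q.
have := @le_integral_add_indic _ _ _ mu Q mQ (leb3_cubeQ_fin R)
  I J _ _ g B l W mS _ mG _ g0 mB BQ l0 mW WQ h.
have S0 x : Q x -> 0 <= \sum_e d2 (Z e) x by move=> _; apply: sumr_ge0 => e _; exact: d2_ge0.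
have G0 x : Q x -> 0 <= #|K|%:R * d2 Y x by move=> _; rewrite mulr_ge0// d2_ge0.
move=> /(_ S0 G0).
have -> : (\int[mu]_(x in Q) (\sum_e d2 (Z e) x)%:E = \sum_e energy (Z e))%E.
  under eq_integral do rewrite -sumEFin.
  rewrite ge0_integral_sum//.
  - by apply: eq_bigr => e _; rewrite energyE.
  - by move=> e; apply/measurable_EFinP; exact: measurable_d2Q.
  - by move=> e x _; rewrite lee_fin d2_ge0.
have -> : (\int[mu]_(x in Q) (#|K|%:R * d2 Y x)%:E = #|K|%:R%:E * energy Y)%E.
  under eq_integral do rewrite EFinM.
  rewrite ge0_integralZl_EFin ?energyE//.
  - by move=> x _; rewrite lee_fin d2_ge0.
  - by apply/measurable_EFinP; exact: measurable_d2Q.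
have Efin : energy Y \is a fin_num by apply: energy_fin => //; case: minY => [[]].
have le : (#|K|%:R%:E * energy Y <= \sum_e energy (Z e))%E.
  have -> : (#|K|%:R%:E * energy Y = \sum_(e : K) energy Y)%E.
    by rewrite -(fineK Efin) sumEFin sumr_const -EFinM mulr_natl.
  by apply: lee_sum => e _; exact: minimizer_le.
move=> H; move: (le_trans (leeD2r _ le) H).
by rewrite -(fineK Efin) -EFinM -!EFinD lee_fin lerD2l.
Qed.

End Exchange.

Section Cells.
Variable R : realType.
Local Notation mR := (measurableTypeR R).
Local Notation mR3 := ((mR * mR * mR)%type).
Local Notation Q := (@cubeQ R : set mR3).

(* Ties between nearest points are broken in favour of the smallest index, so
   that the cells partition the cube and no boundary has to be negligible. *)
Definition cell n (Y : 'I_n -> pt R) (k : 'I_n) : set mR3 :=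
  [set x | [/\ cubeQ x, (forall i, sq x (Y k) <= sq x (Y i)) &
              forall i : 'I_n, (i < k)%N -> sq x (Y k) < sq x (Y i)]].

Lemma cell_sub_cubeQ n (Y : 'I_n -> pt R) k : cell Y k `<=` Q.
Proof. by move=> x []. Qed.

Lemma cell_sub_voronoi n (Y : 'I_n -> pt R) k : cell Y k `<=` voronoi Y k.
Proof. by move=> x [xQ h _]; split=> // i; rewrite edist_leE. Qed.

Lemma measurable_sq_rel (y z : pt R) :
  measurable [set x : mR3 | sq x y <= sq x z] /\ measurable [set x : mR3 | sq x y < sq x z].
Proof.
split; rewrite -[X in measurable X]setTI.
  have := measurable_fun_ler (measurable_sq y) (measurable_sq z).
  by move=> /(_ measurableT [set true]); rewrite /preimage/=; apply.
have := measurable_fun_ltr (measurable_sq y) (measurable_sq z).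
by move=> /(_ measurableT [set true]); rewrite /preimage/=; apply.
Qed.

Lemma measurable_voronoi n (Y : 'I_n -> pt R) k : measurable (voronoi Y k : set mR3).
Proof.
have -> : (voronoi Y k : set mR3) = Q `&` \bigcap_(i in [set: 'I_n]) [set x | sq x (Y k) <= sq x (Y i)].
  apply/seteqP; split=> x.
    by move=> [xQ h]; split=> // i _ /=; rewrite -edist_leE.
  by move=> [xQ h]; split=> // i; rewrite edist_leE; exact: h.
apply: measurableI; first exact: measurable_cubeQ.
by apply: fin_bigcap_measurable => // i _; exact: (measurable_sq_rel _ _).1.
Qed.

Lemma measurable_cell n (Y : 'I_n -> pt R) k : measurable (cell Y k).
Proof.
have -> : cell Y k = (voronoi Y k : set mR3) `&`
    \bigcap_(i in [set i : 'I_n | (i < k)%N]) [set x | sq x (Y k) < sq x (Y i)].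
  apply/seteqP; split=> x.
    by move=> cx; split; [exact: cell_sub_voronoi|case: cx].
  move=> [[xQ h] lt]; split=> //.
  by move=> i; rewrite -edist_leE.
apply: measurableI; first exact: measurable_voronoi.
by apply: fin_bigcap_measurable => // i _; exact: (measurable_sq_rel _ _).2.
Qed.

Lemma cell_inj n (Y : 'I_n -> pt R) (x : mR3) i j : cell Y i x -> cell Y j x -> i = j.
Proof.
move=> [_ hi li] [_ hj lj]; apply: val_inj; apply/eqP.
case: ltngtP => //= ij.
  by have := lj _ ij; rewrite ltNge hi.
by have := li _ ij; rewrite ltNge hj.
Qed.

Lemma cell_cover n (Y : 'I_n -> pt R) (x : mR3) : (0 < n)%N -> Q x -> exists k, cell Y k x.
Proof.
move=> n0 xQ; have [k0 h0] := nearest_index Y x n0.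
pose P (k : 'I_n) := [forall i, sq x (Y k) <= sq x (Y i)].
have Pk0 : P k0 by apply/forallP.
case: (arg_minnP (fun k : 'I_n => val k) Pk0) => k /forallP Pk kmin.
exists k; split=> // i ik; rewrite ltNge; apply/negP => le.
have Pi : P i by apply/forallP => j; exact: le_trans le (Pk j).
by have := kmin _ Pi; rewrite leqNgt ik.
Qed.

Lemma d2_cell n (Y : 'I_n -> pt R) k (x : mR3) : cell Y k x -> d2 Y x = sq x (Y k).
Proof. by move=> [_ h _]; exact: d2_nearest. Qed.

Lemma vol_cells n (Y : 'I_n -> pt R) : (0 < n)%N -> \sum_k vol (cell Y k) = 1.
Proof.
move=> n0; apply/eqP; rewrite eq_le -(@vol_cubeQ R); apply/andP; split.
  apply: vol_packing => //; first exact: measurable_cubeQ.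
  - by move=> k; exact: measurable_cell.
  - by move=> k; exact: cell_sub_cubeQ.
  - exact: cell_inj.
apply: vol_cover => //; first exact: measurable_cubeQ.
- by move=> k; exact: measurable_cell.
- by move=> k; exact: cell_sub_cubeQ.
- by move=> x; exact: cell_cover.
Qed.

Lemma exists_large_cell n (Y : 'I_n -> pt R) : (0 < n)%N ->
  exists k, n%:R^-1 <= vol (cell Y k).
Proof.
move=> n0; apply: contrapT => h.
have lt k : vol (cell Y k) < n%:R^-1.
  by rewrite ltNge; apply/negP => le; apply: h; exists k.
have : \sum_(k < n) vol (cell Y k) < \sum_(k < n) n%:R^-1.
  by apply: ltr_sum => //; apply/hasP; exists (Ordinal n0); rewrite ?mem_index_enum.
by rewrite vol_cells// sumr_const card_ord -(mulr_natr n%:R^-1) mulVf ?ltxx// pnatr_eq0 -lt0n.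
Qed.

Lemma exists_small_cell n (Y : 'I_n -> pt R) : (0 < n)%N ->
  exists k, vol (cell Y k) <= n%:R^-1.
Proof.
move=> n0; apply: contrapT => h.
have lt k : n%:R^-1 < vol (cell Y k).
  by rewrite ltNge; apply/negP => le; apply: h; exists k.
have : \sum_(k < n) n%:R^-1 < \sum_(k < n) vol (cell Y k).
  by apply: ltr_sum => //; apply/hasP; exists (Ordinal n0); rewrite ?mem_index_enum.
by rewrite vol_cells// sumr_const card_ord -(mulr_natr n%:R^-1) mulVf ?ltxx// pnatr_eq0 -lt0n.
Qed.

End Cells.

(** * Geometry of a cell *)

Section CellGeometry.
Variable R : realType.
Local Notation mR := (measurableTypeR R).
Local Notation mR3 := ((mR * mR * mR)%type).
Local Notation Q := (@cubeQ R : set mR3).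

Lemma nearest_neighbor n (Y : 'I_n -> pt R) k : (1 < n)%N ->
  exists i, i != k /\ forall m, m != k -> sq (Y k) (Y i) <= sq (Y k) (Y m).
Proof.
move=> n1; have [i0 i0k] : exists i0 : 'I_n, i0 != k.
  have : (1 < #|'I_n|)%N by rewrite card_ord.
  rewrite (cardD1 k) inE ltnS => /card_gt0P[i0]; rewrite !inE => /andP[i0k _].
  by exists i0.
case: (@arg_minP _ _ _ i0 [pred i | i != k] (fun i => sq (Y k) (Y i)) i0k) => i ik h.
by exists i; split=> // m mk; exact: h.
Qed.

Definition midpoint (x y : pt R) : pt R :=
  (((c1 x + c1 y) / 2, (c2 x + c2 y) / 2), (c3 x + c3 y) / 2).

Lemma edist_midpoint (x y : pt R) :
  edist x (midpoint x y) = edist x y / 2 /\ edist (midpoint x y) y = edist x y / 2.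
Proof.
have e0 : 0 <= edist x y / 2 by rewrite divr_ge0// edist_ge0.
split; apply: (pexpIrn (isT : (0 < 2)%N)); rewrite ?nnegrE ?edist_ge0//;
  rewrite expr_div_n !edist_sqr /sq /midpoint /c1 /c2 /c3/=; by field.
Qed.

Lemma cubeQ_midpoint (x y : pt R) : cubeQ x -> cubeQ y -> cubeQ (midpoint x y).
Proof.
move=> [/andP[? ?] [/andP[? ?] /andP[? ?]]] [/andP[? ?] [/andP[? ?] /andP[? ?]]].
by split; [|split]; rewrite /midpoint /c1 /c2 /c3/= -/(c1 _) -/(c2 _) -/(c3 _);
  apply/andP; split; lra.
Qed.

(** A point of [Y] closer to the midpoint than half the distance D from [Y k] to [Y i] would be
    closer than D to [Y k]. *)
Lemma nearest_midpoint_voronoi n (Y : 'I_n -> pt R) k i :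
  (forall m, cubeQ (Y m)) ->
  (forall m, m != k -> sq (Y k) (Y i) <= sq (Y k) (Y m)) ->
  voronoi Y k (midpoint (Y k) (Y i)).
Proof.
move=> YQ near; have [e1 e2] := edist_midpoint (Y k) (Y i).
split; first exact: cubeQ_midpoint.
move=> m; case: (eqVneq m k) => [->//|/near].
rewrite -edist_leE [edist (midpoint _ _) (Y k)]edistC e1 => le.
have := edist_triangle (Y k) (midpoint (Y k) (Y i)) (Y m); rewrite e1; lra.
Qed.

Lemma edist_cubeQ_le2 (x y : pt R) : cubeQ x -> cubeQ y -> edist x y <= 2.
Proof.
move=> xQ yQ; rewrite -(@ler_pXn2r _ 2)// ?nnegrE ?edist_ge0// edist_sqr.
have := sq_cubeQ_le3 xQ yQ; lra.
Qed.

Lemma edist_le_diam n (Y : 'I_n -> pt R) k x y :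
  voronoi Y k x -> voronoi Y k y -> edist x y <= diam (voronoi Y k).
Proof.
move=> Vx Vy; apply: ub_le_sup; last by exists x => //; exists y.
by exists 2 => _ [x' [? _] [y' [? _]] <-]; exact: edist_cubeQ_le2.
Qed.

Lemma diam_le n (Y : 'I_n -> pt R) k (a : R) : (forall m, cubeQ (Y m)) ->
  (forall x y, voronoi Y k x -> voronoi Y k y -> edist x y <= a) ->
  diam (voronoi Y k) <= a.
Proof.
move=> YQ h; have Vk : voronoi Y k (Y k).
  by split=> // i; rewrite edist_leE sqxx sq_ge0.
apply: ge_sup; first by exists (edist (Y k) (Y k)); exists (Y k) => //; exists (Y k).
by move=> _ [x Vx [y Vy <-]]; exact: h.
Qed.

Lemma voronoi_center n (Y : 'I_n -> pt R) k : cubeQ (Y k) -> voronoi Y k (Y k).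
Proof. by move=> YQ; split=> // i; rewrite edist_leE sqxx sq_ge0. Qed.

Lemma diam_ge0 n (Y : 'I_n -> pt R) k : cubeQ (Y k) -> 0 <= diam (voronoi Y k).
Proof.
move=> YQ; have Vk := voronoi_center YQ.
exact: le_trans (edist_ge0 _ _) (edist_le_diam Vk Vk).
Qed.

(** Go through the midpoint of [Y k] and [Y i], which lies in the cell: it is within one diameter of
    [z], and as far from [Y i] as from [Y k], again at most one diameter. *)
Lemma neighbor_le_2diam n (Y : 'I_n -> pt R) k i z :
  (forall m, cubeQ (Y m)) ->
  (forall m, m != k -> sq (Y k) (Y i) <= sq (Y k) (Y m)) ->
  voronoi Y k z -> edist z (Y i) <= 2 * diam (voronoi Y k).
Proof.
move=> YQ near Vz; have Vm := nearest_midpoint_voronoi YQ near.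
have [e1 e2] := edist_midpoint (Y k) (Y i).
have := edist_triangle z (midpoint (Y k) (Y i)) (Y i).
have := edist_le_diam Vz Vm; have := edist_le_diam (voronoi_center (YQ k)) Vm.
rewrite e1 e2; lra.
Qed.

(** Each coordinate varies by at most the diameter on the cell, which therefore fits into a cube of
    that side; this replaces the isodiametric inequality. *)
Lemma vol_cell_le_diam n (Y : 'I_n -> pt R) k : (forall m, cubeQ (Y m)) ->
  vol (cell Y k) <= diam (voronoi Y k) ^+ 3.
Proof.
move=> YQ; set d := diam _.
have d0 : 0 <= d by exact: diam_ge0.
have mC := @measurable_cell R n Y k.
(* [Y] is not assumed injective, and a repeated point of larger index has an empty cell; the infima
   below need a point. *)
have [->|/set0P ne] := eqVneq (cell Y k) set0.
  have -> : vol set0 = 0 :> R by exact: (congr1 fine (measure0 (@leb3 R))).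
  by rewrite exprn_ge0.
have proj (c : pt R -> R) : (forall x y, `|c x - c y| <= edist x y) ->
    exists a, forall x, cell Y k x -> a <= c x <= a + d.
  move=> cl; have bnd x y : cell Y k x -> cell Y k y -> c x <= c y + d.
    move=> /cell_sub_voronoi Vx /cell_sub_voronoi Vy.
    by have := cl x y; have := edist_le_diam Vx Vy; rewrite -/d ler_distl => ? /andP[? ?]; lra.
  have [x0 cx0] := ne.
  exists (inf [set c x | x in cell Y k]) => x cx; apply/andP; split.
    apply: inf_lbound; last by exists x.
    by exists (c x - d) => _ [y cy <-]; rewrite lerBlDr; exact: bnd.
  rewrite -lerBlDr; apply: lb_le_inf; first by exists (c x0); exists x0.
  by move=> _ [y cy <-]; rewrite lerBlDr; exact: bnd.
have coord (a S : R) : a ^+ 2 <= S -> `|a| <= Num.sqrt S.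
  by move=> h; rewrite -sqrtr_sqr ler_wsqrtr.
have [a1 h1] : exists a, forall x, cell Y k x -> a <= c1 x <= a + d.
  by apply: (proj (@c1 R)) => x y; apply: coord;
    have := (sqr_ge0 (c1 x - c1 y), sqr_ge0 (c2 x - c2 y), sqr_ge0 (c3 x - c3 y));
    case=> -[? ?] ?; lra.
have [a2 h2] : exists a, forall x, cell Y k x -> a <= c2 x <= a + d.
  by apply: (proj (@c2 R)) => x y; apply: coord;
    have := (sqr_ge0 (c1 x - c1 y), sqr_ge0 (c2 x - c2 y), sqr_ge0 (c3 x - c3 y));
    case=> -[? ?] ?; lra.
have [a3 h3] : exists a, forall x, cell Y k x -> a <= c3 x <= a + d.
  by apply: (proj (@c3 R)) => x y; apply: coord;
    have := (sqr_ge0 (c1 x - c1 y), sqr_ge0 (c2 x - c2 y), sqr_ge0 (c3 x - c3 y));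
    case=> -[? ?] ?; lra.
have := @vol_le_box R (cell Y k) ((a1, a2), a3) ((a1 + d, a2 + d), a3 + d) mC.
have -> : (c1 ((a1 + d, a2 + d), a3 + d) - c1 ((a1, a2), a3)) *
  (c2 ((a1 + d, a2 + d), a3 + d) - c2 ((a1, a2), a3)) *
  (c3 ((a1 + d, a2 + d), a3 + d) - c3 ((a1, a2), a3)) = d ^+ 3.
  by rewrite /c1 /c2 /c3/=; ring.
apply; rewrite /c1 /c2 /c3/= ?lerDl//.
by move=> x cx; apply/boxP; rewrite /c1 /c2 /c3/=; split; [exact: h1|exact: h2|exact: h3].
Qed.

End CellGeometry.

(** * Level sets of the sup-norm *)

Section Levels.
Variable R : realType.
Local Notation mR := (measurableTypeR R).
Local Notation mR3 := ((mR * mR * mR)%type).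
Local Notation Q := (@cubeQ R : set mR3).

Definition linf (x p : pt R) : R :=
  Num.max (Num.max `|c1 x - c1 p| `|c2 x - c2 p|) `|c3 x - c3 p|.

Lemma linf_ge0 (x p : pt R) : 0 <= linf x p.
Proof. by rewrite /linf !le_max normr_ge0. Qed.

Lemma linf_le (x p : pt R) r : linf x p <= r ->
  [/\ `|c1 x - c1 p| <= r, `|c2 x - c2 p| <= r & `|c3 x - c3 p| <= r].
Proof. by rewrite /linf !ge_max => /andP[/andP[]]. Qed.

Lemma linf_sqr_le (x p : pt R) : linf x p ^+ 2 <= sq x p.
Proof.
rewrite /linf /sq; have h1 := sqr_ge0 (c1 x - c1 p).
have h2 := sqr_ge0 (c2 x - c2 p); have h3 := sqr_ge0 (c3 x - c3 p).
case: (leP `|c1 x - c1 p| `|c2 x - c2 p|) => _;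
  [case: (leP `|c2 x - c2 p| `|c3 x - c3 p|) | case: (leP `|c1 x - c1 p| `|c3 x - c3 p|)] => _;
  rewrite real_normK ?num_real//; lra.
Qed.

Lemma linf_le_sum (x p : pt R) :
  linf x p <= `|c1 x - c1 p| + `|c2 x - c2 p| + `|c3 x - c3 p|.
Proof.
rewrite /linf; have h1 := normr_ge0 (c1 x - c1 p).
have h2 := normr_ge0 (c2 x - c2 p); have h3 := normr_ge0 (c3 x - c3 p).
by rewrite !ge_max; apply/andP; split; [apply/andP; split|]; lra.
Qed.

Lemma measurable_linf (p : pt R) : measurable_fun [set: mR3] (fun x : mR3 => linf x p : mR).
Proof.
have h (c : mR3 -> mR) (a : R) : measurable_fun setT c ->
    measurable_fun setT (fun x : mR3 => `|c x - a| : mR).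
  move=> mc; apply: (measurableT_comp (@normr_measurable R setT)).
  by apply: measurable_funB => //; exact: measurable_cst.
apply: measurable_maxr; first apply: measurable_maxr; apply: h.
- exact: measurable_c1.
- exact: measurable_c2.
- exact: measurable_c3.
Qed.

Lemma measurable_linf_ge (p : pt R) (a : R) : measurable [set x : mR3 | a <= linf x p].
Proof.
rewrite -[X in measurable X]setTI.
have := measurable_fun_ler (measurable_cst a) (measurable_linf p).
by move=> /(_ measurableT [set true]); rewrite /preimage/=; apply.
Qed.

Lemma measurable_linf_le (p : pt R) (a : R) : measurable [set x : mR3 | linf x p <= a].
Proof.
rewrite -[X in measurable X]setTI.
have := measurable_fun_ler (measurable_linf p) (measurable_cst a).
by move=> /(_ measurableT [set true]); rewrite /preimage/=; apply.
Qed.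

Lemma vol_linf_level (A : set mR3) (p : pt R) (r : R) : measurable A -> A `<=` Q -> 0 <= r ->
  vol A - 8 * r ^+ 3 <= vol (A `&` [set x | r <= linf x p]).
Proof.
move=> mA AQ r0; rewrite lerBlDr.
have mB1 : measurable (A `&` [set x | r <= linf x p]).
  by apply: measurableI => //; exact: measurable_linf_ge.
have mB2 : measurable (A `&` [set x | linf x p <= r]).
  by apply: measurableI => //; exact: measurable_linf_le.
have := @vol_cover R bool A (fun b => if b then A `&` [set x | r <= linf x p]
                           else A `&` [set x | linf x p <= r]).
rewrite big_bool/= => H; apply: (le_trans (H mA AQ _ _ _)).
- by case.
- by case=> x [/AQ].
- move=> x Ax; case: (leP r (linf x p)) => [|/ltW] h; first by exists true.
  by exists false.
rewrite lerD2l; apply: (@vol_le_centered_box R _ p r) => // x [_ /=].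
exact: linf_le.
Qed.

Lemma sum_cubes (N : nat) :
  \sum_(l < N) l.+1%:R ^+ 3 = (N%:R * (N%:R + 1)) ^+ 2 / 4 :> R.
Proof.
elim: N => [|N IH]; first by rewrite big_ord0 mul0r expr0n mul0r.
by rewrite big_ord_recr/= IH -natr1; field.
Qed.

End Levels.

(** * Diameter and volume of the cells of a minimizer *)

Section Minimizers.
Variable R : realType.
Local Notation mR := (measurableTypeR R).
Local Notation mR3 := ((mR * mR * mR)%type).
Local Notation Q := (@cubeQ R : set mR3).

Definition coord (e : 'I_3) : pt R -> R :=
  match val e with 0%N => @c1 R | 1%N => @c2 R | _ => @c3 R end.

Definition shift (e : 'I_3) (a : R) (p : pt R) : pt R :=
  match val e with
  | 0%N => ((c1 p + a, c2 p), c3 p)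
  | 1%N => ((c1 p, c2 p + a), c3 p)
  | _ => ((c1 p, c2 p), c3 p + a) end.

Lemma sq_shift e a (x p : pt R) :
  sq x (shift e a p) = sq x p - 2 * a * (coord e x - coord e p) + a ^+ 2.
Proof.
rewrite /shift /coord /sq; case: (val e) => [|[|?]]; rewrite /c1 /c2 /c3/=; ring.
Qed.

Lemma sum_coord_norm (x p : pt R) :
  \sum_(e < 3) `|coord e x - coord e p| = `|c1 x - c1 p| + `|c2 x - c2 p| + `|c3 x - c3 p|.
Proof. by rewrite !big_ord_recr big_ord0/= add0r. Qed.

Definition move_point n (Y : 'I_n -> pt R) (k : 'I_n) (p : pt R) : 'I_n -> pt R :=
  fun m => if m == k then p else Y m.

(** The slot [k] of the deleted point receives one half of the split point, which keeps the number
    of points. *)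
Definition split_point n (Y : 'I_n -> pt R) (k j : 'I_n) (e : 'I_3) (t : R) :=
  move_point (move_point Y j (shift e (- t) (Y j))) k (shift e t (Y j)).

Lemma split_point_le n (Y : 'I_n -> pt R) k j e t x : j != k -> 0 <= t ->
  d2 (split_point Y k j e t) x + 2 * t * `|coord e x - coord e (Y j)| <= sq x (Y j) + t ^+ 2.
Proof.
move=> jk t0; set Z := split_point _ _ _ _ _.
have h1 := d2_le Z x k; have h2 := d2_le Z x j.
rewrite {2}/Z /split_point /move_point eqxx sq_shift in h1.
rewrite {2}/Z /split_point /move_point (negbTE jk) eqxx sq_shift in h2.
by case: (ger0P (coord e x - coord e (Y j))) => _; lra.
Qed.

Lemma split_point_other n (Y : 'I_n -> pt R) k j e t x m : m != k -> m != j ->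
  d2 (split_point Y k j e t) x <= sq x (Y m).
Proof.
move=> mk mj; have := d2_le (split_point Y k j e t) x m.
by rewrite {2}/split_point /move_point (negbTE mk) (negbTE mj).
Qed.

(** The 32 levels of width s/64 exhaust the half-side s/2 of a cube of volume s^3, and 528^2 is the
    sum of the first 32 cubes. For vj = s^3 they give a mean m of about 0.367 s for [linf]; the gain
    2 t m - 3 t^2 is largest at t = m/3, whence t = 3/25 s. The total coefficient of vj is positive,
    so the case vj = s^3 is the worst. *)
Lemma split_arith (s a vj vk : R) : 0 <= s -> s ^+ 3 <= vj ->
  2 * (3 / 25 * s) * (s / 64) * (32 * vj - 8 * (s / 64) ^+ 3 * 528 ^+ 2) <=
    3 * (3 / 25 * s) ^+ 2 * vj + 3 * (a + (3 / 25 * s) ^+ 2) * vk ->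
  1 / 70 * s ^+ 5 <= (a + 9 / 625 * s ^+ 2) * vk.
Proof.
move=> s0 /(ler_wpM2l (sqr_ge0 s)); rewrite -exprD => h1 h2.
have s5 : 0 <= s ^+ 5 by exact: exprn_ge0.
lra.
Qed.

(* Deleting a point and splitting the point of a large cell in two along one
   of the three axes: averaging over the axes makes the gain at least a
   multiple of the first moment of the sup-norm, estimated by a layer cake. *)
Lemma minimizer_deletion n (Y : 'I_n -> pt R) k i (s a : R) : (1 < n)%N ->
  minimizer Y -> 0 < s -> s ^+ 3 = n%:R^-1 -> vol (cell Y k) < n%:R^-1 -> 0 <= a ->
  i != k -> (forall z, cell Y k z -> sq z (Y i) <= a) ->
  1 / 70 * s ^+ 5 <= (a + 9 / 625 * s ^+ 2) * vol (cell Y k).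
Proof.
move=> n1 minY s0 s3 small a0 ik loss.
have n0 : (0 < n)%N by exact: ltn_trans n1.
have [j large] := exists_large_cell Y n0.
have jk : j != k by apply: contraL small => /eqP <-; rewrite -leNgt.
have [t tE] : exists t : R, t = 3 / 25 * s by eexists.
have t0 : 0 <= t by rewrite tE; lra.
have [de deE] : exists de : R, de = s / 64 by eexists.
have de0 : 0 <= de by rewrite deE; lra.
pose B (l : 'I_32) : set mR3 := cell Y j `&` [set x | l.+1%:R * de <= linf x (Y j)].
pose W (b : bool) : set mR3 := if b then cell Y j else cell Y k.
pose lo (b : bool) : R := if b then 3 * t ^+ 2 else 3 * (a + t ^+ 2).
have mB l : measurable (B l).
  by apply: measurableI; [exact: measurable_cell|exact: measurable_linf_ge].
have BQ l : B l `<=` Q by move=> x [/cell_sub_cubeQ].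
have mW b : measurable (W b) by case: b; exact: measurable_cell.
have WQ b : W b `<=` Q by case: b => x /cell_sub_cubeQ.
have g0 : 0 <= 2 * t * de by apply: mulr_ge0 => //; lra.
have lo0 b : 0 <= lo b.
  by rewrite /lo; case: b; rewrite mulr_ge0 ?addr_ge0 ?sqr_ge0.
have key (x : mR3) : Q x -> \sum_(e < 3) d2 (split_point Y k j e t) x +
    \sum_l 2 * t * de * \1_(B l) x <= #|'I_3|%:R * d2 Y x + \sum_b lo b * \1_(W b) x.
  move=> xQ; rewrite card_ord big_bool/=.
  have [m cm] := cell_cover Y n0 xQ.
  have dE := d2_cell cm.
  have [mj|mj] := eqVneq m j.
    rewrite mj in cm dE.
    have notk : ~ cell Y k x by move=> /(cell_inj cm)/eqP; rewrite (negbTE jk).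
    rewrite !indicE (mem_set cm) (memNset notk) mulr0 addr0 mulr1 dE.
    have lev : \sum_l 2 * t * de * \1_(B l) x <= 2 * t * linf x (Y j).
      have := @layer_cake_sum R 32 (fun l => l%:R * de)
         (fun l => l%:R * de <= linf x (Y j)) (linf x (Y j)).
      move=> H; have {H} := H _ _ (linf_ge0 _ _) (fun _ => id).
      move=> H; apply: le_trans (ler_wpM2l _ (H _ _)) => //; last 3 first.
      - by lra.
      - by move=> p q pq; rewrite ler_wpM2r// ler_nat.
      - by rewrite mul0r.
      rewrite mulr_sumr; apply: ler_sum => l _; rewrite indicE in_setI (mem_set cm)/=.
      have -> : l.+1%:R * de - l%:R * de = de by rewrite -mulrBl -natr1 addrAC subrr add0r mul1r.
      rewrite -(mulrA (2 * t)) (_ : (x \in _) = (l.+1%:R * de <= linf x (Y j)))//.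
      by apply/idP/idP => [/set_mem//|le]; exact: mem_set.
    (* Over the three axes the gains add up to the l1-distance, which dominates [linf]. *)
    have : \sum_(e < 3) (d2 (split_point Y k j e t) x + 2 * t * `|coord e x - coord e (Y j)|) <=
        \sum_(e < 3) (sq x (Y j) + t ^+ 2).
      by apply: ler_sum => e _; exact: split_point_le.
    rewrite big_split/= -mulr_sumr sum_coord_norm sumr_const card_ord -(mulr_natl (_ + _)).
    move=> H; have := linf_le_sum x (Y j).
    have t2 : 0 <= 2 * t by lra.
    by move=> /(ler_wpM2l t2); lra.
  rewrite [X in _ + X <= _]big1 ?addr0; last first.
    move=> l _; rewrite indicE memNset ?mulr0// => -[/(cell_inj cm) mj' _].
    by rewrite mj' eqxx in mj.
  have notj : ~ cell Y j x by move=> /(cell_inj cm)/eqP; rewrite (negbTE mj).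
  rewrite !indicE (memNset notj) mulr0 add0r.
  have const (b : R) : (forall e, d2 (split_point Y k j e t) x <= b) ->
      \sum_(e < 3) d2 (split_point Y k j e t) x <= 3 * b.
    move=> H; apply: (@le_trans _ _ (\sum_(e < 3) b)); first exact: ler_sum.
    by rewrite sumr_const card_ord mulr_natl.
  have [mk|mk] := eqVneq m k.
    rewrite mk in cm; rewrite (mem_set cm) mulr1.
    have : \sum_(e < 3) d2 (split_point Y k j e t) x <= 3 * (a + t ^+ 2).
      apply: const => e; have lossx := loss _ cm.
      (* The neighbour taking over the deleted cell may be the point being split; using its halves
         instead costs t^2 more. *)
      have [ij|ij] := eqVneq i j.
        rewrite ij in lossx.
        have := @split_point_le n Y k j e t x jk t0.
        have : 0 <= 2 * t * `|coord e x - coord e (Y j)| by apply: mulr_ge0 => //; lra.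
        by lra.
      have := split_point_other Y e t x ik ij; have := sqr_ge0 t; lra.
    rewrite /lo; have := d2_ge0 Y x; lra.
  have notk : ~ cell Y k x by move=> /(cell_inj cm)/eqP; rewrite (negbTE mk).
  rewrite (memNset notk) mulr0 addr0 dE.
  by apply: const => e; exact: split_point_other.
have := @minimizer_exchange R n Y _ _ _ _ _ B lo W n0 minY (fun=> g0) mB BQ lo0 mW WQ key.
rewrite big_bool/=.
set vj := vol (cell Y j); set vk := vol (cell Y k) => H.
have lower : 2 * t * de * (32 * vj - 8 * de ^+ 3 * 528 ^+ 2) <=
    \sum_(l < 32) 2 * t * de * vol (B l).
  rewrite -mulr_sumr; apply: ler_wpM2l; first exact: g0.
  have <- : \sum_(l < 32) (vj - 8 * (l.+1%:R * de) ^+ 3) = 32 * vj - 8 * de ^+ 3 * 528 ^+ 2.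
    rewrite sumrB sumr_const card_ord mulr_natl; congr (_ - _).
    under eq_bigr do rewrite exprMn [_ * de ^+ 3]mulrC mulrA.
    by rewrite -mulr_sumr sum_cubes; field.
  apply: ler_sum => l _; apply: vol_linf_level.
  - exact: measurable_cell.
  - exact: cell_sub_cubeQ.
  - by rewrite mulr_ge0.
have {lower H} := le_trans lower H; rewrite /lo tE deE.
by apply: split_arith; [exact: ltW|rewrite s3].
Qed.

End Minimizers.

(** * Covering radius, and the bounds on diameter and volume *)

Section CoveringRadius.
Variable R : realType.
Local Notation mR := (measurableTypeR R).
Local Notation mR3 := ((mR * mR * mR)%type).
Local Notation Q := (@cubeQ R : set mR3).

(** 7/4 is a rational bound for sqrt 3. *)
Lemma linf_edist_le (x p : pt R) (r : R) : 0 <= r -> linf x p <= r -> edist x p <= 7 / 4 * r.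
Proof.
move=> r0 /linf_le[h1 h2 h3]; rewrite -(@ler_pXn2r _ 2)// ?nnegrE ?edist_ge0//; last lra.
rewrite edist_sqr /sq.
have sqn (a : R) : `|a| <= r -> a ^+ 2 <= r ^+ 2.
  by move=> h; rewrite -(real_normK (num_real a)) ler_pXn2r// nnegrE.
have := sqn _ h1; have := sqn _ h2; have := sqn _ h3; have := sqr_ge0 r; lra.
Qed.

(** With D the distance to the nearest neighbour, points of the cube of half-side D/4 about [Y k]
    are within 7/16 D < D/2 of it, hence strictly closer to it than to the other points. As D <= 2,
    this half-side is at most 1/2 and [corner_box_le_vol] applies. *)
Lemma nearest_neighbor_le n (Y : 'I_n -> pt R) k i : config Y -> (1 < n)%N ->
  i != k -> (forall m, m != k -> sq (Y k) (Y i) <= sq (Y k) (Y m)) ->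
  (edist (Y k) (Y i) / 4) ^+ 3 <= vol (cell Y k).
Proof.
move=> [Yinj YQ] n1 ik near; set D := edist _ _.
have D2 : D <= 2 by exact: edist_cubeQ_le2.
have D0 : 0 < D.
  rewrite lt_neqAle edist_ge0 andbT eq_sym; apply/eqP => D0.
  have : sq (Y k) (Y i) = 0 by rewrite -edist_sqr -/D D0 expr0n.
  by move=> /(@sq_eq0 R)/Yinj/esym/eqP; rewrite (negbTE ik).
apply: (@corner_box_le_vol R (cell Y k) (Y k)) => //.
- exact: measurable_cell.
- exact: cell_sub_cubeQ.
- lra.
- lra.
move=> x xQ [h1 h2 h3].
have xk : edist x (Y k) <= 7 / 4 * (D / 4).
  by apply: linf_edist_le; [lra|rewrite /linf !ge_max h1 h2 h3].
have lt m : m != k -> sq x (Y k) < sq x (Y m).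
  move=> /near; rewrite -edist_leE -/D => le; rewrite ltNge -edist_leE -ltNge.
  by have := edist_triangle (Y k) x (Y m); rewrite [edist (Y k) x]edistC; lra.
split=> // m; first by have [->//|/lt/ltW] := eqVneq m k.
by move=> mk; apply: lt; rewrite -val_eqE/= neq_ltn mk.
Qed.

(** The hypothesis reads r^5 <= 4^7 (r + s) s^4. If r > 12 s, then r^5 >= 12^4 r s^4, and 12^4 = 4^7
    + 17 * 4^4 leaves r <= 64/17 s, a contradiction. *)
Lemma relocation_arith (r s : R) : 0 <= r -> 0 < s ->
  r ^+ 2 / 2 * (r / 8) ^+ 3 <= 16 * (r + s) * s * s ^+ 3 -> r <= 12 * s.
Proof.
move=> r0 s0 h; rewrite leNgt; apply/negP => lt.
have s4 : 0 < s ^+ 4 by exact: exprn_gt0.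
have r4 : (12 * s) ^+ 4 <= r ^+ 4.
  by rewrite ler_pXn2r ?nnegrE ?(ltW lt) ?mulr_ge0 ?(ltW s0).
have h5 : r ^+ 5 <= 4 ^+ 7 * (r + s) * s ^+ 4 by lra.
have := le_trans (ler_wpM2l r0 r4) _ => /(_ (r ^+ 5)); rewrite -exprS lexx => /(_ isT) h6.
have : (r * (17 * 4 ^+ 4)) * s ^+ 4 <= (4 ^+ 7 * s) * s ^+ 4 by lra.
rewrite ler_pM2r// => h7; lra.
Qed.

(* Moving the point of a small cell to a point [x] far from [Y]: the gain near
   [x] is of order the fifth power of the distance, and minimality bounds it. *)
Lemma minimizer_relocation n (Y : 'I_n -> pt R) (s rho : R) x : (1 < n)%N -> minimizer Y ->
  0 < s -> s ^+ 3 = n%:R^-1 -> cubeQ x ->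
  (forall z, cubeQ z -> d2 Y z <= rho ^+ 2) -> 0 <= rho ->
  rho <= 2 * Num.sqrt (d2 Y x) -> rho <= 24 * s.
Proof.
move=> n1 minY s0 s3 xQ rhoP rho0; have n0 : (0 < n)%N by exact: ltn_trans n1.
have [cY _] := minY; have [Yinj YQ] := cY.
have [r rE] : exists r : R, r = Num.sqrt (d2 Y x) by eexists.
have r0 : 0 <= r by rewrite rE sqrtr_ge0.
have r2E : r ^+ 2 = d2 Y x by rewrite rE sqr_sqrtr// d2_ge0.
rewrite -rE => rho_r.
have rle z i : cubeQ z -> r - edist z x <= edist z (Y i).
  move=> zQ; have : r <= edist x (Y i).
    by rewrite rE ler_wsqrtr// -/(sq x (Y i)) d2_le.
  by have := edist_triangle x z (Y i); rewrite [edist x z]edistC; lra.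
have r2 : r <= 2.
  have := d2_le3 YQ xQ n0; rewrite -r2E => h.
  by rewrite -(@ler_pXn2r _ 2)// ?nnegrE//; lra.
have [m small] := exists_small_cell Y n0.
have [i [im near]] := nearest_neighbor Y m n1.
have [D DE] : exists D : R, D = edist (Y m) (Y i) by eexists.
have D0 : 0 <= D by rewrite DE edist_ge0.
have Ds : D <= 4 * s.
  have := nearest_neighbor_le cY n1 im near; rewrite -DE => h.
  have : (D / 4) ^+ 3 <= s ^+ 3 by rewrite s3; exact: le_trans h small.
  by rewrite ler_pXn2r// ?nnegrE; lra.
(* On [B] the distance to x is at most 7/32 r < r/4, and that to [Y] at least 3/4 r; the gain is at
   least (9/16 - 1/16) r^2. *)
pose B : set mR3 := Q `&` [set z | linf z x <= r / 8].
have mB : measurable B.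
  by apply: measurableI; [exact: measurable_cubeQ|exact: measurable_linf_le].
have BQ : B `<=` Q by move=> z [].
have mW := @measurable_cell R n Y m.
have g0 : 0 <= r ^+ 2 / 2 by have := sqr_ge0 r; lra.
(* Bounds (d + D)^2 - d^2 for every distance d <= rho, the price of serving the cell of [m] from its
   neighbour. *)
have [lo loE] : exists lo : R, lo = 2 * rho * D + D ^+ 2 by eexists.
have lo0 : 0 <= lo by rewrite loE addr_ge0 ?sqr_ge0// mulr_ge0// mulr_ge0.
have gain z : B z -> d2 (move_point Y m x) z + r ^+ 2 / 2 <= d2 Y z.
  move=> [zQ zx]; have r80 : 0 <= r / 8 by lra.
  have zx' := linf_edist_le r80 zx.
  have e0 := edist_ge0 z x.
  have le1 : d2 (move_point Y m x) z <= (r / 4) ^+ 2.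
    apply: le_trans (d2_le _ _ m) _; rewrite /move_point eqxx -edist_sqr.
    by rewrite ler_pXn2r// ?nnegrE; lra.
  have le2 : (3 / 4 * r) ^+ 2 <= d2 Y z.
    apply: le_d2 => // j; rewrite -edist_sqr; have := rle _ j zQ => h.
    by rewrite ler_pXn2r// ?nnegrE ?edist_ge0//; lra.
  have r20 := sqr_ge0 r; lra.
have loss z : cell Y m z -> d2 (move_point Y m x) z <= d2 Y z + lo.
  move=> cz; rewrite (d2_cell cz).
  have zQ := cell_sub_cubeQ cz.
  have zm : edist z (Y m) <= rho.
    have := rhoP _ zQ; rewrite (d2_cell cz) -edist_sqr => h.
    by move: h; rewrite ler_pXn2r// ?nnegrE// edist_ge0.
  apply: le_trans (d2_le _ _ i) _; rewrite /move_point (negbTE im).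
  have zi := edist_triangle z (Y m) (Y i); rewrite -DE in zi.
  have : sq z (Y i) <= (edist z (Y m) + D) ^+ 2.
    by rewrite -edist_sqr ler_pXn2r// ?nnegrE ?addr_ge0 ?edist_ge0.
  rewrite -edist_sqr loE sqrrD => h; have := ler_wpM2r D0 zm.
  rewrite -edist_sqr; lra.
have other z j : cell Y j z -> j != m -> d2 (move_point Y m x) z <= d2 Y z.
  move=> cz jm; rewrite (d2_cell cz); apply: le_trans (d2_le _ _ j) _.
  by rewrite /move_point (negbTE jm).
have key z : Q z -> \sum_(e < 1) d2 (move_point Y m x) z +
    \sum_(e < 1) r ^+ 2 / 2 * \1_B z <= #|'I_1|%:R * d2 Y z + \sum_(e < 1) lo * \1_(cell Y m) z.
  move=> zQ; rewrite card_ord mul1r !big_ord1.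
  have c0 : 0 <= \1_(cell Y m) z :> R by [].
  have [zB|zB] := pselect (B z).
    rewrite [\1_B z]indicE (mem_set zB) mulr1.
    have := gain _ zB; have := mulr_ge0 lo0 c0; lra.
  rewrite [\1_B z]indicE (memNset zB) mulr0 addr0.
  have [j cj] := cell_cover Y n0 zQ.
  have [jm|jm] := eqVneq j m.
    rewrite jm in cj; rewrite indicE (mem_set cj) mulr1; exact: loss.
  have := other _ _ cj jm; have := mulr_ge0 lo0 c0; lra.
have := @minimizer_exchange R n Y 'I_1 'I_1 'I_1 (fun=> move_point Y m x) (fun=> r ^+ 2 / 2)
  (fun=> B) (fun=> lo) (fun=> cell Y m) n0 minY (fun=> g0) (fun=> mB) (fun=> BQ)
  (fun=> lo0) (fun=> mW) (fun=> @cell_sub_cubeQ R n Y m) key.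
rewrite !big_ord1 => H.
have vB : (r / 8) ^+ 3 <= vol B.
  apply: (@corner_box_le_vol R B x) => //; [lra|lra|].
  move=> z zQ [h1 h2 h3]; split=> //=.
  by rewrite /linf !ge_max h1 h2 h3.
have H1 : r ^+ 2 / 2 * (r / 8) ^+ 3 <= lo * s ^+ 3.
  apply: le_trans (le_trans (ler_wpM2l g0 vB) H) _.
  by apply: ler_wpM2l => //; rewrite s3.
have lo_le : lo <= 16 * (r + s) * s.
  have : 2 * rho * D <= 16 * r * s.
    have : rho * D <= (2 * r) * (4 * s) by apply: ler_pM.
    lra.
  have : D ^+ 2 <= (4 * s) ^+ 2 by rewrite ler_pXn2r// ?nnegrE; lra.
  by rewrite loE exprMn; lra.
have s3p : 0 < s ^+ 3 by exact: exprn_gt0.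
suff : r <= 12 * s by move: rho_r; clear; lra.
apply: relocation_arith => //.
apply: le_trans H1 _.
by apply: ler_wpM2r => //; exact: ltW.
Qed.

(** A point whose distance to [Y] exceeds half the supremum stands in for a maximizer; this is the
    factor 2 in the hypothesis of [minimizer_relocation]. *)
Lemma minimizer_covering n (Y : 'I_n -> pt R) (s : R) : (1 < n)%N -> minimizer Y ->
  0 < s -> s ^+ 3 = n%:R^-1 -> forall x, cubeQ x -> d2 Y x <= (24 * s) ^+ 2.
Proof.
move=> n1 minY s0 s3; have n0 : (0 < n)%N by exact: ltn_trans n1.
have [[_ YQ] _] := minY.
pose S := [set Num.sqrt (d2 Y x) | x in @cubeQ R].
have ubS : has_ubound S.
  exists 2 => _ [x xQ <-]; rewrite -(@ler_pXn2r _ 2)// ?nnegrE ?sqrtr_ge0//.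
  rewrite sqr_sqrtr ?d2_ge0//; have := d2_le3 YQ xQ n0; lra.
have Sk : S (Num.sqrt (d2 Y (Y (Ordinal n0)))) by exists (Y (Ordinal n0)).
have hS : has_sup S by split=> //; exists (Num.sqrt (d2 Y (Y (Ordinal n0)))).
have leS x : cubeQ x -> Num.sqrt (d2 Y x) <= sup S.
  by move=> xQ; apply: ub_le_sup => //; exists x.
have S0 : 0 <= sup S by apply: le_trans (sqrtr_ge0 _) (leS _ (YQ (Ordinal n0))).
have d2S x : cubeQ x -> d2 Y x <= (sup S) ^+ 2.
  move=> xQ; rewrite -(sqr_sqrtr (d2_ge0 Y x)) ler_pXn2r// ?nnegrE ?sqrtr_ge0//.
  exact: leS.
suff S24 : sup S <= 24 * s.
  move=> x xQ; apply: le_trans (d2S _ xQ) _.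
  by rewrite ler_pXn2r// ?nnegrE//; lra.
have [S_eq0|S_neq0] := eqVneq (sup S) 0; first by rewrite S_eq0; lra.
have Spos : 0 < sup S by rewrite lt_neqAle eq_sym S_neq0.
have [_ [x xQ <-] lt] := @sup_adherent _ S (sup S / 2) ltac:(lra) hS.
apply: (minimizer_relocation n1 minY s0 s3 xQ d2S S0); lra.
Qed.

Lemma minimizer_diam n (Y : 'I_n -> pt R) (s : R) k : (0 < n)%N -> minimizer Y ->
  0 < s -> s ^+ 3 = n%:R^-1 -> diam (voronoi Y k) <= 48 * s.
Proof.
move=> n0 minY s0 s3; have [[_ YQ] _] := minY.
apply: diam_le => // x y Vx Vy.
(* Relocation needs a second point; for n = 1, s = 1 and the size of the cube suffices. *)
have [n1|n1] := leqP n 1.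
  have s1 : s = 1.
    apply: (@pexpIrn _ 3) => //; rewrite ?nnegrE ?ltW// s3 expr1n.
    by have -> : n = 1%N; [apply/eqP; rewrite eqn_leq n1|rewrite invr1].
  have := edist_cubeQ_le2 (proj1 Vx) (proj1 Vy); rewrite s1; lra.
have h z : voronoi Y k z -> edist z (Y k) <= 24 * s.
  move=> [zQ hz]; have := minimizer_covering n1 minY s0 s3 zQ.
  rewrite (@d2_nearest _ _ _ _ k); last by move=> i; rewrite -edist_leE.
  by rewrite -edist_sqr ler_pXn2r// ?nnegrE ?edist_ge0//; lra.
have := edist_triangle x (Y k) y; have := h _ Vx; have := h _ Vy.
by rewrite [edist y _]edistC; lra.
Qed.

Lemma small_cell_not_single n (Y : 'I_n -> pt R) k : vol (cell Y k) < n%:R^-1 -> (1 < n)%N.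
Proof.
move=> small; rewrite ltnNge; apply/negP => n1.
have n0 : (0 < n)%N by exact: leq_ltn_trans (leq0n k) (ltn_ord k).
have [j large] := exists_large_cell Y n0.
have jk : j = k.
  apply: val_inj; have := leq_trans (ltn_ord j) n1; have := leq_trans (ltn_ord k) n1.
  by rewrite /= !ltnS !leqn0 => /eqP-> /eqP->.
by move: large; rewrite jk leNgt small.
Qed.

Lemma minimizer_deletion_diam n (Y : 'I_n -> pt R) k (s d : R) : minimizer Y ->
  0 < s -> s ^+ 3 = n%:R^-1 -> vol (cell Y k) < n%:R^-1 -> diam (voronoi Y k) <= d ->
  1 / 70 * s ^+ 5 <= (4 * d ^+ 2 + 9 / 625 * s ^+ 2) * vol (cell Y k).
Proof.
move=> minY s0 s3 small dk; have n1 := small_cell_not_single small.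
have [[_ YQ] _] := minY.
have [i [ik near]] := nearest_neighbor Y k n1.
have d0 := diam_ge0 (YQ k).
apply: (minimizer_deletion n1 minY s0 s3 small _ ik) => [|z cz].
  by have := sqr_ge0 d; lra.
have := neighbor_le_2diam YQ near (cell_sub_voronoi cz) => h.
have : sq z (Y i) <= (2 * d) ^+ 2.
  by rewrite -edist_sqr ler_pXn2r// ?nnegrE ?edist_ge0//; lra.
by rewrite exprMn; lra.
Qed.

(** The deletion bound at diameter 48 s: 70 (4 * 48^2 + 9/625) is slightly less than 10^7 / 15. *)
Lemma minimizer_vol_cell n (Y : 'I_n -> pt R) k (s : R) : minimizer Y ->
  0 < s -> s ^+ 3 = n%:R^-1 -> 15 / 10 ^+ 7 * s ^+ 3 <= vol (cell Y k).
Proof.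
move=> minY s0 s3; rewrite leNgt; apply/negP => lt.
have n0 : (0 < n)%N by exact: leq_ltn_trans (leq0n k) (ltn_ord k).
have s3p : 0 < s ^+ 3 by exact: exprn_gt0.
have small : vol (cell Y k) < n%:R^-1 by rewrite -s3; lra.
have := minimizer_deletion_diam minY s0 s3 small (minimizer_diam k n0 minY s0 s3).
have s2p : 0 < s ^+ 2 by exact: exprn_gt0.
have -> : 4 * (48 * s) ^+ 2 + 9 / 625 * s ^+ 2 = (4 * 48 ^+ 2 + 9 / 625) * s ^+ 2 by field.
have -> : s ^+ 5 = s ^+ 2 * s ^+ 3 by rewrite -exprD.
move=> h.
nra.
Qed.

(** A cell of diameter below g s has volume at most g^3 s^3, so the deletion bound gives 1/70 <= 4
    g^5 + 9/625 g^3. This fails for g^5 <= 1/294, the bound available for [Gamma3]; 9/28 lies just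
    above the fifth root of 1/294. *)
Lemma minimizer_diam_ge n (Y : 'I_n -> pt R) k (s g : R) : minimizer Y ->
  0 < s -> s ^+ 3 = n%:R^-1 -> 0 <= g -> g ^+ 5 <= 1 / 294 -> g * s <= diam (voronoi Y k).
Proof.
move=> minY s0 s3 g0 g5; rewrite leNgt; apply/negP => lt.
have [[_ YQ] _] := minY.
have d0 := diam_ge0 (YQ k).
have gs : g <= 9 / 28.
  rewrite leNgt; apply/negP => gt.
  have : (9 / 28) ^+ 5 <= g ^+ 5 by rewrite ler_pXn2r// ?nnegrE; lra.
  lra.
have g3 : g ^+ 3 <= 1 / 30.
  have : g ^+ 3 <= (9 / 28) ^+ 3 by rewrite ler_pXn2r// ?nnegrE; lra.
  lra.
have s3p : 0 < s ^+ 3 by exact: exprn_gt0.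
have s5p : 0 < s ^+ 5 by exact: exprn_gt0.
have s2p : 0 < s ^+ 2 by exact: exprn_gt0.
have gs0 : 0 <= g * s by rewrite mulr_ge0// ltW.
have v3 : vol (cell Y k) <= g ^+ 3 * s ^+ 3.
  rewrite -exprMn; apply: le_trans (vol_cell_le_diam k YQ) _.
  by rewrite ler_pXn2r// ?nnegrE ?ltW.
have small : vol (cell Y k) < n%:R^-1 by rewrite -s3; nra.
have := minimizer_deletion_diam minY s0 s3 small (ltW lt).
set c := 4 * _ ^+ 2 + _ => h.
have c0 : 0 <= c by rewrite /c exprMn; have := sqr_ge0 g; nra.
have := le_trans h (ler_wpM2l c0 v3).
have -> : c * (g ^+ 3 * s ^+ 3) = (4 * g ^+ 5 + 9 / 625 * g ^+ 3) * s ^+ 5.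
  by rewrite /c; ring.
rewrite ler_pM2r//; lra.
Qed.

End CoveringRadius.

(** * Faces *)

Section Planes.
Variable R : realType.
Implicit Types a b u v w x y p q r : pt R.

Lemma dot_self_gt0 a : a <> pzero R -> 0 < dot a a.
Proof.
move=> a0; rewrite lt_neqAle eq_sym; apply/andP; split; last first.
  by rewrite /dot -!expr2 !addr_ge0 ?sqr_ge0.
apply/negP; rewrite /dot -!expr2 !paddr_eq0 ?addr_ge0 ?sqr_ge0// !sqrf_eq0.
move: a a0 => [[a1 a2] a3]; rewrite /c1 /c2 /c3/=.
by move=> a0 /andP[/andP[/eqP e1 /eqP e2] /eqP e3]; apply: a0; rewrite e1 e2 e3.
Qed.

(** A normal orthogonal to [u] and [v] is parallel to N = u x v. The identity in the proof expands
    (N x a).(N x w) in two ways, by Lagrange and by N x a = (a.u) v - (a.v) u, which vanishes. *)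
Lemma plane_through a u v w : a <> pzero R -> cross u v <> pzero R ->
  dot a u = 0 -> dot a v = 0 -> (dot a w = 0 <-> dot (cross u v) w = 0).
Proof.
move=> a0 /dot_self_gt0 N0 au av; set N := cross u v in N0 *.
have id w' : dot N N * dot a w' - dot a N * dot N w' =
    dot a v * dot (cross N u) w' - dot a u * dot (cross N v) w'.
  by rewrite /N /dot /cross /c1 /c2 /c3/=; ring.
have {}id w' : dot N N * dot a w' = dot a N * dot N w'.
  by apply/eqP; rewrite -subr_eq0 id au av !mul0r subrr.
have aN : dot a N != 0.
  apply/eqP => aN; have := id a; rewrite aN mul0r => /eqP.
  by rewrite mulf_eq0 !gt_eqF//; exact: dot_self_gt0.
split=> h.
  have := id w; rewrite h mulr0 => /esym/eqP.
  by rewrite mulf_eq0 (negbTE aN) => /eqP.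
have := id w; rewrite h mulr0 => /eqP.
by rewrite mulf_eq0 gt_eqF//= => /eqP.
Qed.

Lemma same_plane a a' u v w : a <> pzero R -> a' <> pzero R -> cross u v <> pzero R ->
  dot a u = 0 -> dot a v = 0 -> dot a' u = 0 -> dot a' v = 0 ->
  (dot a w = 0 <-> dot a' w = 0).
Proof.
move=> a0 a'0 N0 au av a'u a'v.
by rewrite (plane_through w a0 N0 au av) (plane_through w a'0 N0 a'u a'v).
Qed.

Lemma dot_psub a x y : dot a (psub x y) = dot a x - dot a y.
Proof. by rewrite /dot /psub /c1 /c2 /c3/=; ring. Qed.

Lemma finite_small (T : finType) (P : T -> R -> Prop) :
  (forall c, exists2 e, 0 < e & forall e', 0 < e' <= e -> P c e') ->
  exists2 e, 0 < e & forall c, P c e.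
Proof.
move=> h; suff [e e0 he] : exists2 e, 0 < e &
    forall c, c \in enum T -> forall e', 0 < e' <= e -> P c e'.
  by exists e => // c; apply: (he c); rewrite ?mem_enum// e0 lexx.
elim: (enum T) => [|c s [e e0 he]]; first by exists 1.
have [e1 e10 h1] := h c; exists (Num.min e e1); first by rewrite lt_min e0.
move=> c'; rewrite inE => /predU1P[->|c's] e' /andP[e'0]; rewrite le_min => /andP[? ?].
  by apply: h1; rewrite e'0.
by apply: he => //; rewrite e'0.
Qed.

(* The barycentre of three non-collinear points of the face cannot satisfy all
   the constraints strictly, and a constraint tight there is tight at the three
   points, hence defines the same plane as the face. *)
Lemma face_tight (T : finType) (nv : T -> pt R) (ofs : T -> R) (V F : set (pt R)) :
  (forall x, V x <-> forall c, dot (nv c) x <= ofs c) -> is_face V F ->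
  exists c, [/\ nv c <> pzero R, F = [set x | V x /\ dot (nv c) x = ofs c] &
                exists p, F p].
Proof.
move=> VE [a [b [a0 [Vb [FE [p [q [r [Fp [Fq [Fr N0]]]]]]]]]]].
have [Vp pb] : V p /\ dot a p = b by move: Fp; rewrite FE.
have [Vq qb] : V q /\ dot a q = b by move: Fq; rewrite FE.
have [Vr rb] : V r /\ dot a r = b by move: Fr; rewrite FE.
(* The barycentre pushed by [e] along the outer normal [a]: if no constraint is tight at [g 0], then
   [g e] stays in [V] for small e > 0, although [dot a (g e) > b]. *)
pose g e : pt R := (((c1 p + c1 q + c1 r) / 3 + e * c1 a, (c2 p + c2 q + c2 r) / 3 + e * c2 a),
  (c3 p + c3 q + c3 r) / 3 + e * c3 a).
have dg w e : dot w (g e) = (dot w p + dot w q + dot w r) / 3 + e * dot w a.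
  by rewrite /dot /g /c1 /c2 /c3/=; field.
have le3 c : [/\ dot (nv c) p <= ofs c, dot (nv c) q <= ofs c & dot (nv c) r <= ofs c].
  by split; [exact: (proj1 (VE p))|exact: (proj1 (VE q))|exact: (proj1 (VE r))].
have [[c [nc tight]]|none] := pselect (exists c, nv c <> pzero R /\ dot (nv c) (g 0) = ofs c).
  have [lp lq lr] := le3 c; rewrite dg mul0r addr0 in tight.
  have ep : dot (nv c) p = ofs c by lra.
  have eq' : dot (nv c) q = ofs c by lra.
  have er : dot (nv c) r = ofs c by lra.
  exists c; split=> //; last by exists p.
  rewrite FE; apply/seteqP; split=> x [Vx h]; split=> //.
    apply/eqP; rewrite -subr_eq0 -ep -dot_psub; apply/eqP.
    apply/(same_plane _ a0 nc N0); rewrite ?dot_psub ?pb ?qb ?rb ?ep ?eq' ?er ?h ?subrr//.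
  apply/eqP; rewrite -subr_eq0 -pb -dot_psub; apply/eqP.
  apply/(same_plane _ a0 nc N0); rewrite ?dot_psub ?pb ?qb ?rb ?ep ?eq' ?er ?h ?subrr//.
have [e e0 he] : exists2 e, 0 < e & forall c, dot (nv c) (g e) <= ofs c.
  apply: (@finite_small T (fun c e => dot (nv c) (g e) <= ofs c)) => c.
  have [lp lq lr] := le3 c.
  (* Zero normals do occur: the bisector of [Y k] with itself. *)
  have [nc|nc] := pselect (nv c = pzero R).
    exists 1 => // e _; rewrite dg nc in lp *.
    have z x : dot (pzero R) x = 0 by rewrite /dot /pzero /c1 /c2 /c3/= !mul0r !addr0.
    by rewrite !z in lp *; lra.
  have lt : dot (nv c) (g 0) < ofs c.
    rewrite lt_neqAle; apply/andP; split; last by rewrite dg; lra.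
    by apply/eqP => t; apply: none; exists c.
  rewrite dg mul0r addr0 in lt.
  set m := (_ + _ + _) / 3 in lt.
  have n1 : 0 < `|dot (nv c) a| + 1 by have := normr_ge0 (dot (nv c) a); lra.
  exists ((ofs c - m) / (`|dot (nv c) a| + 1)); first by rewrite divr_gt0// subr_gt0.
  move=> e' /andP[e'0]; rewrite ler_pdivlMr// dg -/m => h.
  have := ler_wpM2l (ltW e'0) (ler_norm (dot (nv c) a)); lra.
have := Vb (g e) (proj2 (VE _) he).
rewrite dg pb qb rb; have := dot_self_gt0 a0 => aa.
have := mulr_gt0 e0 aa; lra.
Qed.

End Planes.

Section Faces.
Variable R : realType.
Local Notation mR := (measurableTypeR R).
Local Notation mR3 := ((mR * mR * mR)%type).
Local Notation Q := (@cubeQ R : set mR3).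

Definition basis_vec (e : 'I_3) (t : R) : pt R := shift e t (pzero R).

Definition normal_of n (Y : 'I_n -> pt R) (k : 'I_n) (c : 'I_3 * bool + 'I_n) : pt R :=
  match c with
  | inl (e, b) => basis_vec e (if b then 1 else -1)
  | inr i => psub (Y i) (Y k)
  end.

Definition offset_of n (Y : 'I_n -> pt R) (k : 'I_n) (c : 'I_3 * bool + 'I_n) : R :=
  match c with
  | inl (e, b) => if b then 1 else 0
  | inr i => (dot (Y i) (Y i) - dot (Y k) (Y k)) / 2
  end.

Lemma dot_basis_vec e t x : dot (basis_vec e t) x = t * coord e x.
Proof.
rewrite /basis_vec /shift /coord /dot; case: (val e) => [|[|?]];
  rewrite /pzero /c1 /c2 /c3/= ?add0r ?mul0r ?addr0 ?add0r//.
Qed.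

Lemma bisectorE (x y z : pt R) :
  (sq x y <= sq x z) = (dot (psub z y) x <= (dot z z - dot y y) / 2) /\
  (sq x y = sq x z <-> dot (psub z y) x = (dot z z - dot y y) / 2).
Proof.
have e : sq x y - sq x z = 2 * (dot (psub z y) x - (dot z z - dot y y) / 2).
  by rewrite /sq /dot /psub /c1 /c2 /c3/=; field.
split; last by split=> h; lra.
by apply/idP/idP => h; lra.
Qed.

Lemma voronoi_constraints n (Y : 'I_n -> pt R) k x :
  voronoi Y k x <-> forall c, dot (normal_of Y k c) x <= offset_of Y k c.
Proof.
split.
  move=> [[/andP[? ?] [/andP[? ?] /andP[? ?]]] h] [[e b]|i]/=.
    rewrite dot_basis_vec; have : 0 <= coord e x <= 1.
      by rewrite /coord; case: (val e) => [|[|?]]; apply/andP.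
    by case: b => /andP[? ?]; lra.
  by rewrite -(proj1 (bisectorE x (Y k) (Y i))) -edist_leE.
move=> h; split; last first.
  by move=> i; rewrite edist_leE (proj1 (bisectorE x (Y k) (Y i))); exact: (h (inr i)).
have b (e : 'I_3) : 0 <= coord e x <= 1.
  have := h (inl (e, true)); have := h (inl (e, false)).
  by rewrite /= !dot_basis_vec => ? ?; apply/andP; split; lra.
by split; [exact: (b ord0)|split; [exact: (b (@Ordinal 3 1 isT))|exact: (b (@Ordinal 3 2 isT))]].
Qed.

(** A face is determined by a tight constraint: one of the 6 sides of the cube, or the bisector with
    some [Y j] whose cell touches this one. The cell of such a [j] lies within two diameters, 96 s,
    of [Y k]; dividing 8 (96 s)^3 by the least volume of a cell bounds their number. *)
Lemma minimizer_faces n (Y : 'I_n -> pt R) k (N : R) : minimizer Y ->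
  6 + 8 * 96 ^+ 3 / (15 / 10 ^+ 7) <= N -> at_most_faces (voronoi Y k) N.
Proof.
move=> minY HN m F faceF injF; apply: le_trans HN.
have n0 : (0 < n)%N by exact: leq_ltn_trans (leq0n k) (ltn_ord k).
have [s s0 s3] : exists2 s : R, 0 < s & s ^+ 3 = n%:R^-1.
  have np : 0 < n%:R^-1 :> R by rewrite invr_gt0 ltr0n.
  exists (powR n%:R^-1 3^-1); first exact: powR_gt0.
  by rewrite -powR_mulrn ?powR_ge0// -powRrM mulVf ?powRr1 ?ltW.
pose A : set mR3 := Q `&` [set z | linf z (Y k) <= 96 * s].
pose Nb := [set i | `[< cell Y i `<=` A >]]%SET.
have mA : measurable A.
  by apply: measurableI; [exact: measurable_cubeQ|exact: measurable_linf_le].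
have AQ : A `<=` Q by move=> z [].
have card_Nb : #|Nb|%:R <= 8 * 96 ^+ 3 / (15 / 10 ^+ 7) :> R.
  pose B i := if i \in Nb then cell Y i else set0.
  have mB i : measurable (B i) by rewrite /B; case: ifP => _ //; exact: measurable_cell.
  have BA i : B i `<=` A by rewrite /B; case: ifP => //; rewrite inE => /asboolP.
  have Bi x i : B i x -> cell Y i x by rewrite /B; case: ifP.
  have pack := vol_packing mA AQ mB BA (fun x i j Bix Bjx => cell_inj (Bi _ _ Bix) (Bi _ _ Bjx)).
  have s960 : 0 <= 96 * s by lra.
  have volA : vol A <= 8 * (96 * s) ^+ 3.
    by apply: (@vol_le_centered_box R A (Y k)) => // x [_ /linf_le].
  have low : \sum_(i in Nb) (15 / 10 ^+ 7 * s ^+ 3) <= \sum_i vol (B i).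
    rewrite [leRHS](bigID (mem Nb))/=; apply: ler_wpDr.
      by apply: sumr_ge0 => i _; exact: vol_ge0.
    apply: ler_sum => i iN; rewrite /B iN.
    exact: minimizer_vol_cell.
  have := le_trans low (le_trans pack volA).
  rewrite sumr_const -(mulr_natl (_ * _)) => h.
  rewrite ler_pdivlMr; last by rewrite divr_gt0// exprn_gt0.
  rewrite -(@ler_pM2r _ (s ^+ 3)) ?exprn_gt0//; move: h; rewrite exprMn; lra.
have H (i : 'I_m) : exists c, F i = [set x | voronoi Y k x /\
      dot (normal_of Y k c) x = offset_of Y k c] /\ forall j, c = inr j -> j \in Nb.
  have [c [nc FE [p Fp]]] := face_tight (voronoi_constraints Y k) (faceF i (ltn_ord i)).
  exists c; split=> // j cj; rewrite cj/= in nc FE; rewrite inE; apply/asboolP => z cz.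
  move: Fp; rewrite FE => -[Vp /(proj2 (bisectorE p (Y k) (Y j))) eqp].
  have Vjp : voronoi Y j p.
    by case: Vp => pQ h; split=> // l; rewrite edist_leE -eqp -edist_leE.
  have := minimizer_diam k n0 minY s0 s3; have := minimizer_diam j n0 minY s0 s3.
  have := edist_le_diam (cell_sub_voronoi cz) Vjp.
  have [[_ YQ] _] := minY.
  have := edist_le_diam Vp (voronoi_center (YQ k)).
  have := edist_triangle z p (Y k) => h1 h2 h3 h4 h5.
  split; first exact: cell_sub_cubeQ cz.
  rewrite /= -(@ler_pXn2r _ 2)// ?nnegrE ?linf_ge0//; last lra.
  apply: le_trans (linf_sqr_le _ _) _; rewrite -edist_sqr ler_pXn2r// ?nnegrE ?edist_ge0//; lra.
have [f fP] := choice H.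
have f_inj : injective f.
  move=> i j fij; apply: val_inj; apply: (injF _ _ (ltn_ord i) (ltn_ord j)).
  by rewrite /= (proj1 (fP i)) (proj1 (fP j)) fij.
have sub : (f @: [set: 'I_m] \subset
    [set inl u | u in [set: 'I_3 * bool]] :|: [set inr i | i in Nb])%SET.
  apply/fintype.subsetP => _ /imsetP[i _ ->]; rewrite inE.
  case E: (f i) => [u|j]; apply/orP; [left|right].
    by apply/imsetP; exists u.
  by apply/imsetP; exists j => //; exact: (proj2 (fP i)).
have := subset_leq_card sub; rewrite card_imset// cardsT card_ord => le.
have : (m <= 6 + #|Nb|)%N.
  apply: (leq_trans le); apply: (leq_trans (leq_card_setU _ _)).
  rewrite leq_add// (leq_trans (leq_imset_card _ _))// cardsT card_prod card_ord card_bool//.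
by rewrite -(ler_nat R) natrD; lra.
Qed.

End Faces.

(** * Energy lower bound and scaling *)

Section EnergyLowerBound.
Variable R : realType.
Local Notation mR := (measurableTypeR R).
Local Notation mR3 := ((mR * mR * mR)%type).
Local Notation mu := (@leb3 R).
Local Notation Q := (@cubeQ R : set mR3).

Lemma vol_far n (Y : 'I_n -> pt R) (r : R) : 0 <= r ->
  measurable (Q `&` [set x | forall i, r <= linf x (Y i)] : set mR3) /\
  1 - n%:R * (8 * r ^+ 3) <= vol (Q `&` [set x | forall i, r <= linf x (Y i)]).
Proof.
move=> r0; set B := Q `&` _.
have mQ := @measurable_cubeQ R.
have mB : measurable B.
  rewrite /B (_ : [set x | _] = \bigcap_(i in [set: 'I_n]) [set x : mR3 | r <= linf x (Y i)]).
    by apply: measurableI => //; apply: fin_bigcap_measurable => // i _; exact: measurable_linf_ge.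
  by apply/seteqP; split=> x h i; [move=> _|]; exact: h.
split=> //; pose C (o : option 'I_n) := if o is Some i then Q `&` [set x | linf x (Y i) <= r] else B.
have mC o : measurable (C o).
  by case: o => [i|] //=; apply: measurableI => //; exact: measurable_linf_le.
have CQ o : C o `<=` Q by case: o => [i|] x [].
rewrite lerBlDr.
have := @vol_cover R _ Q C mQ (fun _ => id) mC CQ.
have cover x : Q x -> exists o, C o x.
  move=> xQ; have [[i h]|none] := pselect (exists i, linf x (Y i) <= r).
    by exists (Some i).
  by exists None; split=> // i; case: (leP r (linf x (Y i))) => // /ltW h; case: none; exists i.
move=> /(_ cover); rewrite vol_cubeQ => /le_trans; apply.
rewrite (bigD1 None)//= lerD2l.
rewrite (eq_bigl (fun o => o \in [set Some i | i : 'I_n]%SET)); last first.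
  move=> [i|]/=; first by rewrite imset_f.
  by apply/esym/negP => /imsetP[].
rewrite big_imset/=; last by move=> i j _ _ [].
apply: (@le_trans _ _ (\sum_(i < n) 8 * r ^+ 3)).
  rewrite [leLHS](eq_bigl xpredT)//.
  apply: ler_sum => i _.
  apply: (@vol_le_centered_box R _ (Y i)) => //; first exact: (mC (Some i)).
  by move=> x [_ /linf_le].
by rewrite sumr_const card_ord -(mulr_natl (8 * r ^+ 3)).
Qed.

(** The bound 1 - 8 n r^3 on the volume at sup-distance at least r from [Y] vanishes at r = s/2, the
    last of the eight levels. Integrating 2 r (1 - 8 n r^3) would give 3/20 s^2; eight steps still
    give about 0.126 s^2. *)
Lemma energy_ge n (Y : 'I_n -> pt R) (s : R) : (0 < n)%N -> 0 < s -> s ^+ 3 = n%:R^-1 ->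
  ((3 / 25 * s ^+ 2)%:E <= energy Y)%E.
Proof.
move=> n0 s0 s3.
have [de deE] : exists de : R, de = s / 16 by eexists.
have de0 : 0 <= de by rewrite deE; lra.
pose B (l : 'I_8) : set mR3 := Q `&` [set x | forall i, l.+1%:R * de <= linf x (Y i)].
pose g (l : 'I_8) : R := (l.+1%:R * de) ^+ 2 - (l%:R * de) ^+ 2.
have far (l : 'I_8) := vol_far Y (mulr_ge0 (ler0n _ l.+1) de0).
have mB l : measurable (B l) by have [] := far l.
have BQ l : B l `<=` Q by move=> x [].
have g0 l : 0 <= g l.
  rewrite subr_ge0 ler_pXn2r// ?nnegrE ?mulr_ge0//.
  by rewrite ler_wpM2r// ler_nat.
have key x : Q x -> cst 0 x + \sum_l g l * \1_(B l) x <=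
    d2 Y x + \sum_(j < 0) cst 0 j * \1_(cst set0 j) x.
  move=> xQ; rewrite big_ord0 addr0 add0r.
  have := @layer_cake_sum R 8 (fun l => (l%:R * de) ^+ 2)
     (fun l => `[< forall i, l%:R * de <= linf x (Y i) >]) (d2 Y x).
  move=> H; apply: le_trans _ (H _ _ (d2_ge0 _ _) _).
  - apply: ler_sum => l _; rewrite indicE ler_wpM2l// ?g0// ler_nat.
    case: asboolP => h; first exact: leq_b1.
    by rewrite memNset// => -[].
  - move=> p q pq; rewrite ler_pXn2r// ?nnegrE ?mulr_ge0//.
    by rewrite ler_wpM2r// ler_nat.
  - by rewrite mul0r expr0n.
  - move=> l /asboolP h; apply: le_d2 => // i.
    apply: le_trans (linf_sqr_le _ _).
    by rewrite ler_pXn2r// ?nnegrE ?linf_ge0 ?mulr_ge0.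
have := @le_integral_add_indic _ _ _ mu Q (@measurable_cubeQ R) (leb3_cubeQ_fin R)
  'I_8 'I_0 (cst 0) (d2 Y) g B (cst 0) (cst set0) (measurable_cst _) (fun _ _ => lexx _)
  (measurable_d2Q Y n0) (fun x _ => d2_ge0 Y x) g0 mB BQ (fun=> lexx _)
  (fun=> measurable0) (fun=> @sub0set _ _) key.
rewrite big_ord0 adde0 integral0 add0e -energyE//.
move=> H; apply: (le_trans _ H); rewrite lee_fin.
apply: (@le_trans _ _ (\sum_(l < 8) g l * (1 - n%:R * (8 * (l.+1%:R * de) ^+ 3)))); last first.
  by apply: ler_sum => l _; apply: ler_wpM2l; [exact: g0|exact: (far l).2].
have n3 : n%:R * s ^+ 3 = 1 by rewrite s3 mulfV// pnatr_eq0 -lt0n.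
have e l : n%:R * (8 * (l.+1%:R * de) ^+ 3) = l.+1%:R ^+ 3 / 512.
  transitivity (l.+1%:R ^+ 3 / 512 * (n%:R * s ^+ 3)); last by rewrite n3 mulr1.
  by rewrite deE; field.
rewrite (eq_bigr (fun l : 'I_8 => ((l.+1%:R * (s / 16)) ^+ 2 - (l%:R * (s / 16)) ^+ 2) *
  (1 - l.+1%:R ^+ 3 / 512))); last by move=> l _; rewrite e /g deE.
rewrite !big_ord_recr big_ord0/=.
have := sqr_ge0 s; lra.
Qed.

End EnergyLowerBound.

(* [scales m phi c]: the change of variables formula for phi, with constant
   Jacobian c^-1; it passes to products by Tonelli's theorem. *)
Definition scales d (T : measurableType d) (R : realType) (m : {measure set T -> \bar R})
    (phi : T -> T) (c : R) := measurable_fun setT phi /\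
  forall h : T -> \bar R, measurable_fun setT h -> (forall x, 0 <= h x)%E ->
    (\int[m]_x h (phi x) = c%:E * \int[m]_x h x)%E.

Section Scaling.
Variable R : realType.
Local Notation mR := (measurableTypeR R).
Local Notation mR3 := ((mR * mR * mR)%type).
Local Notation mu := (@leb3 R).
Local Notation lam := (@lebesgue_measure R).
Local Notation Q := (@cubeQ R : set mR3).

Lemma scales_prod d1 d2 (T1 : measurableType d1) (T2 : measurableType d2)
    (m1 : {sigma_finite_measure set T1 -> \bar R})
    (m2 : {sigma_finite_measure set T2 -> \bar R}) phi1 phi2 (a b : R) :
  0 <= a -> 0 <= b -> scales m1 phi1 a -> scales m2 phi2 b ->
  scales (m1 \x m2)%E (fun x => (phi1 x.1, phi2 x.2)) (a * b).
Proof.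
move=> a0 b0 [mphi1 s1] [mphi2 s2].
have mphi : measurable_fun setT (fun x : T1 * T2 => (phi1 x.1, phi2 x.2)).
  apply: measurable_fun_pair.
    exact: (measurableT_comp mphi1 measurable_fst).
  exact: (measurableT_comp mphi2 measurable_snd).
split=> // h mh h0.
have mhx x : measurable_fun setT (fun y => h (x, y)).
  exact: (measurableT_comp mh (measurable_pair1 x)).
have mhphi := measurableT_comp mh mphi.
have h0' x : (0 <= (h \o (fun x : T1 * T2 => (phi1 x.1, phi2 x.2))) x)%E by exact: h0.
rewrite (@fubini_tonelli1 _ _ _ _ _ m1 m2 _ mhphi h0').
rewrite (@fubini_tonelli1 _ _ _ _ _ m1 m2 h)// /fubini_F/=.
under eq_integral do rewrite (s2 (fun y => h (phi1 _, y)))//.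
have mF := @measurable_fun_fubini_tonelli_F _ _ _ _ _ m2 h mh h0.
rewrite /fubini_F in mF.
have F0 x : (0 <= \int[m2]_y h (x, y))%E by exact: integral_ge0.
rewrite ge0_integralZl_EFin//; last exact: (measurableT_comp mF mphi1).
by rewrite (s1 (fun x => \int[m2]_y h (x, y))%E)// muleA -EFinM mulrC.
Qed.

(** Twice the pushforward agrees with Lebesgue measure on half-open intervals, hence everywhere by
    uniqueness. *)
Lemma scales_affine (c : R) : scales lam (fun x : mR => 2 * x - c : mR) 2^-1.
Proof.
have mphi : measurable_fun setT (fun x : mR => 2 * x - c : mR).
  by apply: measurable_funB; [exact: measurable_funM|exact: measurable_cst].
split=> // h mh h0.
pose phi : mR -> mR := fun x => 2 * x - c.
pose pf := pushforward lam phi.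
have hp : 0 <= 2^-1 :> R by rewrite invr_ge0.
pose k2 := NngNum (ler0n R 2); pose kh := NngNum hp.
have E A : measurable A -> pf A = mscale kh lam A.
  move=> mA.
  have := @lebesgue_measure_unique R (mscale k2 pf).
  move=> /(_ mphi _ A mA) H; rewrite /mscale/= H.
    by rewrite /mscale/= muleA -EFinM mulVf ?mul1e.
  move=> _ [[a b] _ <-]; transitivity (2%:E * lam (phi @^-1` `]a, b]%classic))%E; last by [].
  have -> : phi @^-1` `]a, b]%classic = `](a + c) / 2, (b + c) / 2]%classic.
    apply/seteqP; split=> x; rewrite /phi /=; rewrite !in_itv/= => /andP[? ?]; apply/andP; split; lra.
  rewrite !lebesgue_measure_itv/= !lte_fin.
  have -> : ((a + c) / 2 < (b + c) / 2) = (a < b) by apply/idP/idP; lra.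
  case: ifP => _; last by rewrite mule0.
  by rewrite -EFinD -EFinM; congr EFin; field.
transitivity (\int[pf]_y h y)%E.
  by rewrite ge0_integral_pushforward.
transitivity (\int[mscale kh lam]_y h y)%E.
  by apply: eq_measure_integral => A mA _; exact: E.
by rewrite ge0_integral_mscale.
Qed.

Definition double (b : pt R) (x : mR3) : mR3 :=
  ((2 * c1 x - c1 b, 2 * c2 x - c2 b), 2 * c3 x - c3 b).

(** The first factor of [leb3] is itself a product, and Tonelli's theorem requires it to be
    sigma-finite. *)
Lemma sigma_finite_lebesgue2 : sigma_finite [set: mR * mR] (lam \x lam)%E.
Proof.
pose I (n : nat) : set mR := `[- n%:R, n%:R]%classic.
have lamI n : (lam (I n) < +oo)%E.
  by rewrite /I lebesgue_measure_itv/= lte_fin; case: ifP => _; rewrite ltry.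
have mI n : measurable (I n) by exact: measurable_itv.
exists (fun n => I n `*` I n).
  apply/seteqP; split=> // -[x y] _.
  have n0 : 0 <= `|x| + `|y| by rewrite addr_ge0.
  exists (Num.bound (`|x| + `|y|)) => //.
  have := archi_boundP n0; have := normr_ge0 x; have := normr_ge0 y => h1 h2 h3.
  by split; rewrite /I /= in_itv/= -ler_norml; lra.
move=> n; split; first exact: measurableX.
rewrite [ltLHS]product_measure1E//; apply: lte_mul_pinfty; [exact: measure_ge0| |exact: lamI].
by rewrite ge0_fin_numE; [exact: lamI|exact: measure_ge0].
Qed.

Lemma scales_double (b : pt R) : scales mu (double b) (1 / 8).
Proof.
have -> : 1 / 8 = 2^-1 * 2^-1 * 2^-1 :> R by field.
have h2 : 0 <= 2^-1 :> R by rewrite invr_ge0.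
have s12 := scales_prod h2 h2 (scales_affine (c1 b)) (scales_affine (c2 b)).
pose m12 : {sigma_finite_measure set (mR * mR)%type -> \bar R} := HB.pack (lam \x lam)%E
  (Measure_isSigmaFinite.Build _ _ _ (lam \x lam)%E sigma_finite_lebesgue2).
exact: (@scales_prod _ _ _ _ m12 lam _ _ _ _ (mulr_ge0 h2 h2) h2 s12 (scales_affine (c3 b))).
Qed.

(** [double] blows each subcube up to the whole cube, and squared distances there shrink by 4; the
    eight Jacobians 1/8 add up to 1. The bound sums over all eight copies, so common sides of
    subcubes are merely overcounted. *)
Lemma energy_copies n m (Y : 'I_n -> pt R) (Z : 'I_m -> pt R) : (0 < n)%N -> (0 < m)%N ->
  (forall (b : bool * bool * bool) i, exists j, Z j =
     (((c1 (Y i) + b.1.1%:R) / 2, (c2 (Y i) + b.1.2%:R) / 2), (c3 (Y i) + b.2%:R) / 2)) ->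
  (energy Z <= (1 / 4)%:E * energy Y)%E.
Proof.
move=> n0 m0 ZY.
pose v (b : bool * bool * bool) : pt R := ((b.1.1%:R, b.1.2%:R), b.2%:R).
pose h (x : mR3) : \bar R := (1 / 4 * d2 Y x * \1_Q x)%:E.
have mh : measurable_fun setT h.
  apply/measurable_EFinP; apply: measurable_funM.
    by apply: measurable_funM => //; exact: measurable_d2.
  by apply: measurable_indic; exact: measurable_cubeQ.
have h0 x : (0 <= h x)%E.
  by rewrite lee_fin !mulr_ge0// d2_ge0.
have mhd b : measurable_fun setT (fun x => h (double (v b) x)).
  by apply: (measurableT_comp mh); have [] := scales_double (v b).
have hint : (\int[mu]_x h x = (1 / 4)%:E * energy Y)%E.
  rewrite energyE// -ge0_integralZl_EFin//.
  - rewrite [RHS]integral_mkcond; apply: eq_integral => x _.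
    rewrite patchE /h indicE; case: ifP => xQ; first by rewrite mulr1 EFinM.
    by rewrite mulr0.
  - exact: measurable_cubeQ.
  - by move=> x _; rewrite lee_fin d2_ge0.
  - by apply/measurable_EFinP; exact: measurable_d2Q.
have key x : Q x -> ((d2 Z x)%:E <= \sum_(b : bool * bool * bool) h (double (v b) x))%E.
  move=> [x1 [x2 x3]].
  have half (t : R) : 0 <= t <= 1 -> exists b : bool, 0 <= 2 * t - b%:R <= 1.
    move=> /andP[? ?]; case: (leP t (1 / 2)) => ?; [exists false|exists true];
      by apply/andP; split; rewrite /=; lra.
  have [b1 h1] := half _ x1; have [b2 h2] := half _ x2; have [b3 h3] := half _ x3.
  pose b := (b1, b2, b3).
  have dQ : Q (double (v b) x) by split; [|split].
  rewrite (bigD1 b)//=.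
  apply: (@le_trans _ _ (h (double (v b) x))); last first.
    by rewrite leeDl// sume_ge0.
  rewrite /h indicE mem_set// mulr1 lee_fin.
  have [i ->] := d2_attained Y (double (v b) x) n0.
  have [j Zj] := ZY b i.
  apply: le_trans (d2_le Z x j) _; rewrite Zj.
  rewrite le_eqVlt; apply/orP; left; apply/eqP.
  by rewrite /sq /double /v /c1 /c2 /c3/=; field.
rewrite energyE//.
apply: (@le_trans _ _ (\int[mu]_(x in Q) \sum_(b : bool * bool * bool) h (double (v b) x))%E).
  apply: ge0_le_integral => //.
  - exact: measurable_cubeQ.
  - by move=> x _; rewrite lee_fin d2_ge0.
  - by apply/measurable_EFinP; exact: measurable_d2Q.
  - by apply: emeasurable_sum => b; exact: measurable_funTS (mhd b).
apply: (@le_trans _ _ (\int[mu]_x \sum_(b : bool * bool * bool) h (double (v b) x))%E).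
  apply: ge0_subset_integral => //.
  - exact: measurable_cubeQ.
  - by apply: emeasurable_sum => b; exact: mhd.
  - by move=> x _; apply: sume_ge0.
rewrite ge0_integral_sum//.
under eq_bigr => b _ do rewrite (scales_double (v b)).2//.
have Ifin : (0 <= \int[mu]_x h x)%E by exact: integral_ge0.
rewrite -ge0_sume_distrl//.
rewrite sumEFin sumr_const card_prod card_prod card_bool hint.
have -> : (1 / 8 : R) *+ (2 * 2 * 2) = 1 by rewrite -(mulr_natl (1 / 8)); field.
by rewrite mul1e.
Qed.

End Scaling.

(** * Existence of minimizers *)

Section Existence.
Variable R : realType.
Local Notation mR := (measurableTypeR R).
Local Notation mR3 := ((mR * mR * mR)%type).
Local Notation mu := (@leb3 R).
Local Notation Q := (@cubeQ R : set mR3).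

Lemma clamp01_lip (a b : R) : `|clamp01 a - clamp01 b| <= `|a - b|.
Proof.
rewrite ler_norml; have := ler_norm (a - b); have := ler_norm (b - a).
rewrite distrC /clamp01 => h1 h2.
by case: (leP a 1) => ?; case: (leP b 1) => ?; rewrite ?(max_r ler01);
  try (case: (leP 0 a) => ?); try (case: (leP 0 b) => ?); apply/andP; split; lra.
Qed.

Lemma sq_lip (x y z : pt R) (eta : R) : cubeQ x -> cubeQ y -> cubeQ z ->
  `|c1 y - c1 z| <= eta -> `|c2 y - c2 z| <= eta -> `|c3 y - c3 z| <= eta ->
  sq x y <= sq x z + 6 * eta.
Proof.
have one (a b c : R) : 0 <= a <= 1 -> 0 <= b <= 1 -> 0 <= c <= 1 -> `|b - c| <= eta ->
    (a - b) ^+ 2 <= (a - c) ^+ 2 + 2 * eta.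
  move=> /andP[? ?] /andP[? ?] /andP[? ?] h; rewrite -lerBlDl.
  have -> : (a - b) ^+ 2 - (a - c) ^+ 2 = (c - b) * (2 * a - b - c) by ring.
  apply: le_trans (ler_norm _) _; rewrite normrM mulrC.
  apply: ler_pM => //; last by rewrite distrC.
  by rewrite ler_norml; apply/andP; split; lra.
move=> [x1 [x2 x3]] [y1 [y2 y3]] [z1 [z2 z3]] h1 h2 h3.
have := one _ _ _ x1 y1 z1 h1; have := one _ _ _ x2 y2 z2 h2; have := one _ _ _ x3 y3 z3 h3.
by rewrite /sq; lra.
Qed.

Lemma energy_lip n (Y Z : 'I_n -> pt R) (eta : R) : (0 < n)%N ->
  (forall k, cubeQ (Y k)) -> (forall k, cubeQ (Z k)) ->
  (forall k, [/\ `|c1 (Y k) - c1 (Z k)| <= eta, `|c2 (Y k) - c2 (Z k)| <= eta &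
                 `|c3 (Y k) - c3 (Z k)| <= eta]) ->
  fine (energy Y) <= fine (energy Z) + 6 * eta.
Proof.
move=> n0 YQ ZQ h.
have eta0 : 0 <= eta by have [h1 _ _] := h (Ordinal n0); exact: le_trans (normr_ge0 _) h1.
have key x : Q x -> d2 Y x + \sum_(j < 0) cst 0 j * \1_(cst set0 j) x <=
    d2 Z x + \sum_(j < 1) 6 * eta * \1_Q x.
  move=> xQ; rewrite big_ord0 big_ord1 indicE mem_set// mulr1 addr0.
  have [k ->] := d2_attained Z x n0; have [h1 h2 h3] := h k.
  exact: le_trans (d2_le Y x k) (sq_lip xQ (YQ k) (ZQ k) h1 h2 h3).
have eta6 : 0 <= 6 * eta by rewrite mulr_ge0.
have := @le_integral_add_indic _ _ _ mu Q (@measurable_cubeQ R) (leb3_cubeQ_fin R)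
  'I_0 'I_1 (d2 Y) (d2 Z) (cst 0) (cst set0) (fun=> 6 * eta) (fun=> Q)
  (measurable_d2Q Y n0) (fun x _ => d2_ge0 Y x) (measurable_d2Q Z n0) (fun x _ => d2_ge0 Z x)
  (fun=> lexx _) (fun=> measurable0) (fun=> @sub0set _ _)
  (fun=> eta6) (fun=> @measurable_cubeQ R) (fun _ _ => id) key.
rewrite big_ord0 adde0 big_ord1 -!energyE//.
have -> : fine (mu Q) = 1 := vol_cubeQ R.
by rewrite mulr1 -(fineK (energy_fin n0 YQ)) -(fineK (energy_fin n0 ZQ)) -EFinD lee_fin.
Qed.

Lemma cubeQ_compact : compact (@cubeQ R).
Proof.
have -> : @cubeQ R = (`[0, 1] `*` `[0, 1]) `*` `[0, 1].
  apply/seteqP; split=> x.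
    by move=> [h1 [h2 h3]]; split; [split|]; rewrite /= in_itv.
  by move=> [[/=]]; rewrite !in_itv/= => h1 h2 h3.
apply: compact_setX; last exact: segment_compact.
by apply: compact_setX; exact: segment_compact.
Qed.

Import ArrowAsProduct.

(** The factor 6 is the Lipschitz constant of [energy_lip], applied in both directions. *)
Lemma ler_dist_sixths (u v e : R) :
  u <= v + 6 * (e / 6) -> v <= u + 6 * (e / 6) -> `|u - v| <= e.
Proof. by move=> ? ?; rewrite ler_distl; apply/andP; split; lra. Qed.

(** Clamping makes the energy finite and Lipschitz on the whole product space, so continuity need
    not be relative to the cube. *)
Lemma clamped_energy_continuous n : (0 < n)%N ->
  continuous (fun Y : 'I_n -> pt R => fine (energy (fun k => clampQ (Y k)))).
Proof.
move=> n0 Y; have FF : Filter (nbhs Y) by exact: nbhs_filter.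
apply/(@cvgrPdist_le _ _ _ _ FF) => /= e e0.
have near_coord (c : pt R -> R) k : continuous c ->
    \forall Z \near Y, `|c (Y k) - c (Z k)| <= e / 6.
  move=> cc; have cp := @proj_continuous 'I_n (fun=> pt R : topologicalType) k.
  have cck : (fun Z : 'I_n -> pt R => c (Z k)) Z @[Z --> Y] --> c (Y k).
    exact: (continuous_comp (cp Y) (cc _)).
  by move/cvgrPdist_le : cck; apply; lra.
have cc1 : continuous (@c1 R).
  by move=> x; apply: continuous_comp; [exact: cvg_fst|exact: cvg_fst].
have cc2 : continuous (@c2 R).
  by move=> x; apply: continuous_comp; [exact: cvg_fst|exact: cvg_snd].
have cc3 : continuous (@c3 R) by move=> x; exact: cvg_snd.
have near_all : \forall Z \near Y, forall k : 'I_n, [/\ `|c1 (Y k) - c1 (Z k)| <= e / 6,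
    `|c2 (Y k) - c2 (Z k)| <= e / 6 & `|c3 (Y k) - c3 (Z k)| <= e / 6].
  apply: (@filter_forall _ _ _ _ FF) => k.
  have := @filterI _ _ FF _ _ (near_coord _ k cc1) (@filterI _ _ FF _ _ (near_coord _ k cc2) (near_coord _ k cc3)).
  by apply: (@filterS _ _ FF) => Z [? [? ?]]; split.
apply: (@filterS _ _ FF _ _ _ near_all) => Z h.
have le1 := @energy_lip n (fun k => clampQ (Y k)) (fun k => clampQ (Z k)) (e / 6) n0
  (fun k => clampQ_in _) (fun k => clampQ_in _).
have le2 := @energy_lip n (fun k => clampQ (Z k)) (fun k => clampQ (Y k)) (e / 6) n0
  (fun k => clampQ_in _) (fun k => clampQ_in _).
have {}le1 := le1 (fun k => let: And3 h1 h2 h3 := h k in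
  And3 (le_trans (clamp01_lip _ _) h1) (le_trans (clamp01_lip _ _) h2) (le_trans (clamp01_lip _ _) h3)).
have {}le2 : fine (energy (fun k => clampQ (Z k))) <= fine (energy (fun k => clampQ (Y k))) + 6 * (e / 6).
  apply: le2 => k; have [h1 h2 h3] := h k.
  by split; rewrite distrC; apply: le_trans (clamp01_lip _ _) _.
exact: ler_dist_sixths le1 le2.
Qed.

(** Configurations are not a closed set, since points may merge. The minimum is taken over all
    families in the cube and then repaired by [better_config]. *)
Lemma exists_minimizer n : (0 < n)%N -> exists Y : 'I_n -> pt R, minimizer Y.
Proof.
move=> n0.
have cK := @tychonoff 'I_n (fun=> pt R : topologicalType) (fun=> @cubeQ R) (fun=> cubeQ_compact).
have K0 : [set Y : 'I_n -> pt R | forall k, cubeQ (Y k)] !=set0.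
  by exists (fun=> clampQ (pzero R)) => k; exact: clampQ_in.
have [Y _ minY] := @compact_EVT_min ('I_n -> pt R) R _ _ K0 cK
  (continuous_subspaceT (clamped_energy_continuous n0)).
have [Y' [cY' leY']] := better_config (fun k => clampQ (Y k)) n0.
exists Y'; split; first exact: cY'.
move=> Z [_ ZQ]; apply: le_trans leY' _.
have cZ : (fun k => clampQ (Z k)) = Z.
  have c1' t : 0 <= t <= 1 -> clamp01 t = t :> R.
    by move=> /andP[t0 t1]; rewrite /clamp01 (min_l t1) (max_r t0).
  apply/funext => k; have [h1 [h2 h3]] := ZQ k.
  rewrite /clampQ !c1'//.
  by case: (Z k) => [[]].
have ZK : Z \in [set Y : 'I_n -> pt R | forall k, cubeQ (Y k)] by rewrite inE.
have := minY _ ZK; rewrite cZ => h.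
have fY : energy (fun k => clampQ (Y k)) \is a fin_num.
  by apply: energy_fin => // k; exact: clampQ_in.
by rewrite -(fineK fY) -(fineK (energy_fin n0 ZQ)) lee_fin.
Qed.

Lemma exists_minimizers : exists Ys : forall n, 'I_n -> pt R,
  forall n, (0 < n)%N -> minimizer (Ys n).
Proof.
have h n : exists Y : 'I_n -> pt R, (0 < n)%N -> minimizer Y.
  by case: (posnP n) => [->|n0]; [exists (fun=> pzero R)|have [Y] := exists_minimizer n0; exists Y].
exists (fun n => projT1 (cid (h n))) => n.
exact: (projT2 (cid (h n))).
Qed.

End Existence.

(** * Numerical constants *)

Section Constants.
Variable R : realType.

(** With x = sin(pi/6), the triple angle formula 3 x - 4 x^3 = 1 factors as (x + 1)(2 x - 1)^2 = 0,
    so x = 1/2; then sin t <= t at t = pi/6. *)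
Lemma pi_gt3 : 3 <= pi :> R.
Proof.
have p0 := @pi_gt0 R.
have s0 : 0 < sin (pi / 6) :> R by apply: sin_gt0_pi; apply/andP; split; lra.
have e3 : sin (pi / 6 + (pi / 6 + pi / 6)) = 1 :> R.
  by transitivity (sin (pi / 2) : R); [congr sin; field|exact: sin_pihalf].
rewrite sinD (sinD (pi / 6) (pi / 6)) (cosD (pi / 6) (pi / 6)) in e3.
set x := sin (pi / 6) in s0 e3; set y := cos (pi / 6) in e3.
have xy : y ^+ 2 + x ^+ 2 = 1 by exact: cos2Dsin2.
have half : x = 1 / 2.
  have : (x + 1) * (2 * x - 1) ^+ 2 = 0.
    have y2 : y ^+ 2 = 1 - x ^+ 2 by lra.
    have : 3 * x * y ^+ 2 - x ^+ 3 = 1 by apply: etrans e3; ring.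
    by rewrite y2 => h; transitivity (1 - (3 * x * (1 - x ^+ 2) - x ^+ 3)); [ring|rewrite h subrr].
  move=> /eqP; rewrite mulf_eq0 sqrf_eq0 => /orP[/eqP|/eqP]; lra.
have p6 : 0 <= pi / 6 :> R by lra.
have [|c _] := @MVT_segment R sin cos 0 (pi / 6) p6 (fun x _ => is_derive_sin x).
  by apply: continuous_subspaceT => z; exact: continuous_sin.
rewrite sin0 !subr0 -/x half => h.
have := @cos_le1 R c => c1'.
have := ler_wpM2r p6 c1'; lra.
Qed.

Lemma powR_exprn (a r : R) k : 0 <= a -> (powR a r) ^+ k = powR a (r * k%:R).
Proof. by move=> a0; rewrite -powR_mulrn ?powR_ge0// -powRrM. Qed.

Lemma omega3_bounds : 4 <= omega3 R /\ omega3 R <= 16 / 3.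
Proof.
have := pi_gt3; have := @pihalf_lt2 R; rewrite /omega3 => h1 h2; split; lra.
Qed.

Lemma ler_root (a b : R) k : (0 < k)%N -> 0 <= a -> 0 <= b -> a ^+ k <= b ^+ k -> a <= b.
Proof. by move=> k0 a0 b0; rewrite ler_pXn2r// ?nnegrE. Qed.

Lemma Gamma1_bounds : 0 < Gamma1 R /\ Gamma1 R <= 2 / 147.
Proof.
rewrite /Gamma1; set u := powR _ _.
have u0 : 0 < u by apply: powR_gt0; lra.
have u3 : u ^+ 3 = 4 / 25.
  rewrite /u powR_exprn; last lra.
  have -> : 2 / 3 * 3%:R = 2%:R :> R by field.
  by rewrite powR_mulrn; [field|lra].
split; first lra.
apply: (@ler_root _ _ 3); [by []|lra|lra|].
by rewrite expr_div_n u3; lra.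
Qed.

(** [Gamma3 ^+ 5] is [Gamma1 / omega3], at most (2/147) / 4. *)
Lemma Gamma3_bounds : [/\ 0 < Gamma3 R, Gamma3 R ^+ 5 <= 1 / 294 & Gamma3 R <= 1].
Proof.
have [w1 w2] := omega3_bounds; have [g0 g1] := Gamma1_bounds.
have w0 : 0 < omega3 R by lra.
have G0 : 0 < Gamma3 R by rewrite mulr_gt0// powR_gt0.
have G5 : Gamma3 R ^+ 5 <= 1 / 294.
  rewrite /Gamma3 exprMn !powR_exprn ?(ltW w0) ?(ltW g0)//.
  have -> : - (1 / 5) * 5%:R = -1 :> R by field.
  have -> : 1 / 5 * 5%:R = 1 :> R by field.
  rewrite powR_inv1 ?powRr1 ?(ltW w0) ?(ltW g0)//.
  rewrite -(@ler_pM2l _ (omega3 R))// mulrA mulfV ?gt_eqF// mul1r; lra.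
split=> //; apply: (@ler_root _ _ 5); [by []|lra|lra|rewrite expr1n; lra].
Qed.

Lemma sq_term_bounds : 0 < sq_term R /\ sq_term R <= 1 / 100.
Proof.
rewrite /sq_term; set A := 1 + _.
have A1 : (101 / 100) ^+ 2 >= A by rewrite /A; lra.
have A2 : 1 < A by rewrite /A ltrDl; lra.
have up : Num.sqrt A <= 101 / 100.
  apply: (@ler_root _ _ 2); [by []|exact: sqrtr_ge0|lra|].
  by rewrite sqr_sqrtr; lra.
have lo : Num.sqrt 1 < Num.sqrt A by rewrite ltr_sqrt//; lra.
by rewrite sqrtr1 in lo; split; lra.
Qed.

Lemma Gamma5_bounds : 0 < Gamma5 R /\ Gamma5 R <= 1 / 400.
Proof.
have [g0 _ g1] := Gamma3_bounds; have [s0 s1] := sq_term_bounds.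
rewrite /Gamma5; split; first by apply: mulr_gt0 => //; apply: mulr_gt0 => //; lra.
have := ler_pM (ltW s0) (ltW g0) s1 g1; lra.
Qed.

Lemma Gamma4_ge : 100 <= Gamma4 R.
Proof.
have [w1 w2] := omega3_bounds; have [s0 s1] := sq_term_bounds.
have p3 := pi_gt3; have p4 := @pihalf_lt2 R.
have lower (a r b : R) k : (0 < k)%N -> 0 <= b -> 0 <= a -> r * k%:R = 1 -> b ^+ k <= a -> b <= powR a r.
  move=> k0 b0 a0 rk le; apply: (@ler_root _ _ k) => //; first exact: powR_ge0.
  by rewrite powR_exprn// rk powRr1.
have upper (a r b : R) k : (0 < k)%N -> 0 <= b -> 0 <= a -> r * k%:R = 1 -> a <= b ^+ k -> powR a r <= b.
  move=> k0 b0 a0 rk le; apply: (@ler_root _ _ k) => //; first exact: powR_ge0.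
  by rewrite powR_exprn// rk powRr1.
have h1 : 9 / 5 <= powR (12 : R) (1 / 4) by apply: (@lower _ _ _ 4); [by []|lra|lra|field|lra].
have h2 : 5 / 2 <= powR (16 : R) (1 / 3) by apply: (@lower _ _ _ 3); [by []|lra|lra|field|lra].
have h3 : powR (pi : R) (1 / 4) <= 3 / 2 by apply: (@upper _ _ _ 4); [by []|lra|lra|field|lra].
have h4 : powR (omega3 R) (1 / 12) <= 3 / 2 by apply: (@upper _ _ _ 12); [by []|lra|lra|field|lra].
have h5 : 10 <= powR (sq_term R) (- (1 / 2)).
  apply: (@ler_root _ _ 2) => //; first exact: powR_ge0.
  rewrite powR_exprn ?(ltW s0)//; have -> : - (1 / 2) * 2%:R = -1 :> R by field.
  rewrite powR_inv1 ?(ltW s0)// -(@ler_pM2r _ (sq_term R))// mulVf ?gt_eqF//; lra.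
have h6 : 19 / 5 <= powR ((5 ^+ 2 * 10 ^+ 3) / (2 ^+ 2 * 3 ^+ 3) : R) (1 / 4).
  by apply: (@lower _ _ _ 4); [by []|lra|lra|field|lra].
rewrite /Gamma4.
set p12 := powR 12 _ in h1 *; set p16 := powR 16 _ in h2 *; set pp := powR pi _ in h3 *.
set po := powR (omega3 R) _ in h4 *; set ps := powR (sq_term R) _ in h5 *.
set pl := powR (_ / _) _ in h6 *.
have pp0 : 0 < pp by apply: powR_gt0; lra.
have po0 : 0 < po by apply: powR_gt0; lra.
have k1 : 2 * (9 / 5) * (5 / 2) <= 2 * p12 * p16 by apply: ler_pM => //; lra.
have k2 : pp * po <= 3 / 2 * (3 / 2) by apply: ler_pM => //; exact: ltW.
have k3 : 4 <= 2 * p12 * p16 / (pp * po) by rewrite ler_pdivlMr ?mulr_gt0//; lra.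
have k4 : 4 * 10 <= 2 * p12 * p16 / (pp * po) * ps by apply: ler_pM => //; lra.
have k5 : 4 * 10 * (19 / 5) <= 2 * p12 * p16 / (pp * po) * ps * pl by apply: ler_pM => //; lra.
lra.
Qed.

Lemma Nstar_ge : 6 + 8 * 96 ^+ 3 / (15 / 10 ^+ 7) <= Nstar R.
Proof.
have g4 := Gamma4_ge; have [g50 g5] := Gamma5_bounds.
have h : 12 * 10 ^+ 4 <= 3 * Gamma4 R / Gamma5 R.
  rewrite ler_pdivlMr//; apply: (@le_trans _ _ (12 * 10 ^+ 4 * (1 / 400))); last lra.
  by apply: ler_wpM2l => //; rewrite mulr_ge0// exprn_ge0.
have c0 : 0 <= 12 * 10 ^+ 4 :> R by rewrite mulr_ge0// exprn_ge0.
have : (12 * 10 ^+ 4) ^+ 3 <= (3 * Gamma4 R / Gamma5 R) ^+ 3.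
  by rewrite ler_pXn2r// nnegrE ?(le_trans c0).
rewrite /Nstar; lra.
Qed.

Lemma Gamma5_volume : omega3 R * Gamma5 R ^+ 3 <= 15 / 10 ^+ 7.
Proof.
have [w1 w2] := omega3_bounds; have [g50 g5] := Gamma5_bounds.
have h : Gamma5 R ^+ 3 <= (1 / 400) ^+ 3 by rewrite ler_pXn2r// ?nnegrE; lra.
apply: (@le_trans _ _ (16 / 3 * (1 / 400) ^+ 3)); last lra.
by apply: ler_pM => //; [lra|rewrite exprn_ge0// ltW].
Qed.

(** The left side is 3/10 omega3^(-2/3), half of what the layer cake with balls would give; omega3
    >= 4 bounds it by 3/10 * 4/10. *)
Lemma zador_bound_le : (2 * pi / 5) * powR (omega3 R) (- (5 / 3)) <= 3 / 25.
Proof.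
have [w1 w2] := omega3_bounds; have w0 : 0 < omega3 R by lra.
have e1 : 2 * pi / 5 = 3 / 10 * omega3 R by rewrite /omega3; field.
have e2 : omega3 R * powR (omega3 R) (- (5 / 3)) = powR (omega3 R) (- (2 / 3)).
  rewrite -[X in X * _](powRr1 (ltW w0)) -powRD; first by congr powR; field.
  by apply/implyP => _; rewrite gt_eqF.
rewrite e1 -(mulrA (3 / 10)) e2.
suff : powR (omega3 R) (- (2 / 3)) <= 4 / 10 by lra.
apply: (@ler_root _ _ 3); [by []|exact: powR_ge0|lra|].
rewrite powR_exprn ?(ltW w0)//; have -> : - (2 / 3) * 3%:R = - 2%:R :> R by field.
have w2p : 0 < omega3 R ^+ 2 by exact: exprn_gt0.
rewrite powR_invn ?(ltW w0)// -(@ler_pM2r _ (omega3 R ^+ 2))// mulVf ?gt_eqF//.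
have : 4 ^+ 2 <= omega3 R ^+ 2 by rewrite ler_pXn2r// ?nnegrE; lra.
lra.
Qed.

End Constants.

Section Scale.
Variable R : realType.

Lemma powR_third (n : nat) : (0 < n)%N ->
  0 < powR n%:R (- (1 / 3)) :> R /\ powR n%:R (- (1 / 3)) ^+ 3 = n%:R^-1 :> R.
Proof.
move=> n0; split; first by rewrite powR_gt0// ltr0n.
rewrite powR_exprn//; have -> : - (1 / 3) * 3%:R = -1 :> R by field.
by rewrite powR_inv1.
Qed.

Lemma powR_two_thirds (n : nat) : (0 < n)%N ->
  powR n%:R (2 / 3) * powR n%:R (- (1 / 3)) ^+ 2 = 1 :> R.
Proof.
move=> n0; rewrite powR_exprn// -powRD; last by rewrite pnatr_eq0 -lt0n n0 implybT.
have -> : 2 / 3 + - (1 / 3) * 2%:R = 0 :> R by field.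
by rewrite powRr0.
Qed.

Lemma powR_8n (n : nat) : powR (8 * n)%:R (2 / 3) = 4 * powR n%:R (2 / 3) :> R.
Proof.
rewrite natrM powRM//; congr (_ * _).
have h : powR 8 (2 / 3) ^+ 3 = 4 ^+ 3 :> R.
  rewrite powR_exprn//; have -> : 2 / 3 * 3%:R = 2%:R :> R by field.
  by rewrite powR_mulrn//; ring.
by apply: (pexpIrn (isT : (0 < 3)%N)); rewrite ?nnegrE ?powR_ge0.
Qed.

End Scale.

(** * The scaled energy and its limit *)

Section Limit.
Variable R : realType.
Local Open Scope ereal_scope.

Definition scaled_energy n (Y : 'I_n -> pt R) : \bar R := (powR n%:R (2 / 3))%:E * energy Y.

Lemma scaled_energy_ge n (Y : 'I_n -> pt R) : (0 < n)%N -> (3 / 25)%:E <= scaled_energy Y.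
Proof.
move=> n0; have [s0 s3] := powR_third R n0.
have := energy_ge Y n0 s0 s3; have p0 : 0 <= (powR n%:R (2 / 3) : R)%:E by rewrite lee_fin powR_ge0.
move=> /(lee_wpmul2l p0); rewrite -EFinM mulrCA (powR_two_thirds R n0) mulr1.
exact.
Qed.

(** The factor 8^(2/3) = 4 cancels the 1/4 of [energy_copies]. Copies of boundary points may
    coincide, so [Z] need not be a configuration; [minimizer_le] covers this. *)
Lemma scaled_energy_8n n (Y : 'I_n -> pt R) (Y' : 'I_(8 * n) -> pt R) : (0 < n)%N ->
  minimizer Y' -> scaled_energy Y' <= scaled_energy Y.
Proof.
move=> n0 minY'; have n8 : (0 < 8 * n)%N by rewrite muln_gt0.
have e : (8 * n)%N = #|{: bool * bool * bool * 'I_n}|.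
  by rewrite !card_prod card_bool card_ord.
pose Z (j : 'I_(8 * n)) : pt R := let x := enum_val (cast_ord e j) in
  (((c1 (Y x.2) + x.1.1.1%:R) / 2, (c2 (Y x.2) + x.1.1.2%:R) / 2), (c3 (Y x.2) + x.1.2%:R) / 2)%R.
have ZY (b : bool * bool * bool) i : exists j, Z j =
    (((c1 (Y i) + b.1.1%:R) / 2, (c2 (Y i) + b.1.2%:R) / 2), (c3 (Y i) + b.2%:R) / 2)%R.
  by exists (cast_ord (esym e) (enum_rank (b, i))); rewrite /Z cast_ordKV enum_rankK.
have le := le_trans (minimizer_le Z n8 minY') (energy_copies n0 n8 ZY).
have p0 : 0 <= (powR (8 * n)%:R (2 / 3) : R)%:E by rewrite lee_fin powR_ge0.
apply: le_trans (lee_wpmul2l p0 le) _.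
rewrite powR_8n muleA -EFinM /scaled_energy.
by have -> : (4 * powR n%:R (2 / 3) * (1 / 4) = powR n%:R (2 / 3) :> R)%R by field.
Qed.

Lemma scaled_energy_8jn (Ys : forall n, 'I_n -> pt R) : (forall n, (0 < n)%N -> minimizer (Ys n)) ->
  forall n j, (0 < n)%N -> scaled_energy (Ys (8 ^ j * n)%N) <= scaled_energy (Ys n).
Proof.
move=> minY n j n0; elim: j => [|j IH]; first by rewrite expn0 mul1n.
apply: le_trans IH; rewrite expnS -mulnA.
have m0 : (0 < 8 ^ j * n)%N by rewrite muln_gt0 expn_gt0.
by apply: scaled_energy_8n => //; apply: minY; rewrite muln_gt0.
Qed.

End Limit.

Theorem theorem2p3 (R : realType) :
  (* (i) *)
  (forall (n : nat) (Y : 'I_n -> pt R), minimizer Y ->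
    forall k : 'I_n,
      Gamma3 R * powR (n%:R) (- (1 / 3)) <= diam (voronoi Y k) /\
      ((omega3 R * Gamma5 R ^+ 3 / n%:R)%:E <= @leb3 R (voronoi Y k))%E /\
      ((2 < n)%N -> diam (voronoi Y k) <= Gamma4 R * powR (n%:R - 2) (- (1 / 3))) /\
      at_most_faces (voronoi Y k) (Nstar R)) /\
  (* (ii) *)
  (forall tau : R, 0 < tau ->
    (forall Ys : forall n : nat, 'I_n -> pt R,
       (forall n, (0 < n)%N -> minimizer (Ys n)) ->
       ((fun n : nat => ((powR (n%:R) (2 / 3))%:E * energy (Ys n))%E)
          @ \oo --> tau%:E)) ->
    (forall Ys : forall n : nat, 'I_n -> pt R,
       (forall n, (0 < n)%N -> minimizer (Ys n)) ->
       \forall n \near \oo, (tau%:E <= (powR (n%:R) (2 / 3))%:E * energy (Ys n))%E) /\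
    (2 * pi / 5) * powR (omega3 R) (- (5 / 3)) <= tau).
Proof.
split.
  move=> n Y minY k; have n0 : (0 < n)%N by exact: leq_ltn_trans (leq0n k) (ltn_ord k).
  have [s0 s3] := powR_third R n0; set s := powR n%:R _ in s0 s3 *.
  have [g0 g5 _] := Gamma3_bounds R.
  split; first exact: (minimizer_diam_ge k minY s0 s3 (ltW g0) g5).
  split.
    rewrite (leb3_vol (measurable_voronoi Y k)); last by move=> x [].
    rewrite lee_fin -s3.
    apply: (@le_trans _ _ (15 / 10 ^+ 7 * s ^+ 3)).
      by rewrite ler_wpM2r ?exprn_ge0 ?(ltW s0)// Gamma5_volume.
    apply: le_trans (minimizer_vol_cell k minY s0 s3) _.
    apply: vol_le; [exact: measurable_cell|exact: measurable_voronoi| |exact: cell_sub_voronoi].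
    by move=> x [].
  split; last exact: minimizer_faces minY (Nstar_ge R).
  move=> n2; apply: le_trans (minimizer_diam k n0 minY s0 s3) _.
  have n20 : (0 < n - 2)%N by rewrite subn_gt0.
  have [w0 w3] := powR_third R n20; rewrite -natrB; last exact: ltnW.
  (* The bound in n is the stronger one and is relaxed to n - 2. *)
  have sw : s <= powR (n - 2)%:R (- (1 / 3)).
    apply: (@ler_root _ _ _ 3); [by []|exact: ltW|exact: powR_ge0|].
    by rewrite s3 w3 lef_pV2 ?posrE ?ltr0n// ler_nat leq_subr.
  have := Gamma4_ge R => g4.
  by apply: ler_pM => //; [exact: ltW|lra].
move=> tau tau0 H.
have [Ys0 minYs0] := exists_minimizers R.
split.
  move=> Ys minYs; exists 1%N => // n /= n0.
  rewrite -/(scaled_energy (Ys n)) leNgt; apply/negP => lt.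
  (* A value below tau at [n] would be exceeded by all late terms, yet the term at 8^M n is late and
     does not exceed it. *)
  have [M _ hM] := H Ys minYs _ (open_ereal_gt' lt).
  have : (M <= 8 ^ M * n)%N.
    apply: (@leq_trans (8 ^ M)); last exact: leq_pmulr.
    exact/ltnW/ltn_expl.
  move=> /hM /=; rewrite -/(scaled_energy (Ys _)) ltNge.
  by rewrite scaled_energy_8jn.
rewrite -lee_fin; apply: le_trans (_ : (3 / 25)%:E <= _)%E.
  by rewrite lee_fin zador_bound_le.
apply: cvge_ge (H Ys0 minYs0).
by exists 1%N => // n /= n0; exact: scaled_energy_ge.
Qed.
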